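(* Let $k\ge 1$ be a fixed integer. Let $\mathcal{H}_k$ be the set of all nonzero Laurent polynomials with integer coefficients, in any number $\ell\ge 1$ of variables ($\ell$ is not fixed and can be arbitrarily large), that are the sum of at most $k$ monomials. Let $m(\mathcal{H}_k)=\{m(F) : F\in\mathcal{H}_k\}$, where $m$ denotes the logarithmic Mahler measure. Then $m(\mathcal{H}_k)$ is a closed subset of $\mathbb{R}_{\ge 0}$. Furthermore, $0$ is an isolated point of $m(\mathcal{H}_k)$.
   Context: A Laurent polynomial in $\ell$ variables that is the sum of at most $k$ monomials and has integer coefficients is one of the form $F(z_1,\dots,z_\ell)=\sum_{\mathbf{j}\in J}c(\mathbf{j})\,z_1^{j_1}\cdots z_\ell^{j_\ell}$, where $J\subset\mathbb{Z}^\ell$ has $k$ elements $\mathbf{j}=(j_1,\dots,j_\ell)$ and the $c(\mathbf{j})$ are integers, some of which may be $0$. For a nonzero Laurent polynomial $F$ in $\ell$ variables, the logarithmic Mahler measure is $$m(F)=\int_0^1\cdots\int_0^1\log|F(e^{2\pi i t_1},\dots,e^{2\pi i t_\ell})|\,dt_1\cdots dt_\ell .$$ *)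

(* Defs.v *)
From HB Require Import structures.
From mathcomp Require Import all_boot all_order all_algebra.
From mathcomp Require Import finmap monalg complex.
From mathcomp Require Import all_classical all_reals all_analysis.

Set Implicit Arguments.
Unset Strict Implicit.
Unset Printing Implicit Defensive.

Import Order.TTheory GRing.Theory Num.Theory.
Import numFieldNormedType.Exports.

Local Open Scope classical_set_scope.
Local Open Scope ring_scope.
Local Open Scope complex_scope.

(* Integer Laurent polynomials in l variables: finitely supported families of
   integer coefficients indexed by exponent vectors in Z^l (exponents may be
   negative, and [F@_j] is the coefficient of z^j). *)
Definition laurent (l : nat) := {malg int['rV[int]_l]}.

(* The set J may contain exponents whose coefficient is 0. *)
Definition sum_of_monomials (k l : nat) (F : laurent l) : Prop :=
  exists2 J : {fset 'rV[int]_l},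
    (#|` J| = k)%N & (forall j, j \notin J -> F@_j = 0).

Definition laurent_eval (K : fieldType) (l : nat) (F : laurent l)
    (z : 'I_l -> K) : K :=
  \sum_(j <- msupp F) (F@_j)%:~R * \prod_(i < l) z i ^ j ord0 i.

Section Mahler.
Variable R : realType.

(* e^(2 pi i t) *)
Definition expi2pi (t : R) : R[i] := cos (2 * pi * t) +i* sin (2 * pi * t).

(* The iterated integral of f(t_1, ..., t_l) dt_1 ... dt_l over [0, 1]^l;
   the innermost integration is with respect to the first coordinate. *)
Fixpoint iterated_integral (l : nat) : (l.-tuple R -> \bar R) -> \bar R :=
  if l is l'.+1 return (l.-tuple R -> \bar R) -> \bar R then
    fun f => (\int[lebesgue_measure]_(t in `[0%R, 1%R])
               iterated_integral (fun s : l'.-tuple R => f [tuple of rcons s t]))%E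
  else fun f => f [tuple].

(* [lne] is the extended logarithm, with value -oo at 0. *)
Definition mahler (l : nat) (F : laurent l) : \bar R :=
  iterated_integral (fun t : l.-tuple R =>
    lne (Normc.normc (laurent_eval F (fun i => expi2pi (tnth t i))))%:E).

Definition mahler_values (k : nat) : set (\bar R) :=
  [set x | exists (l : nat) (F : laurent l),
     [/\ (1 <= l)%N, F != 0, sum_of_monomials k F & mahler F = x]].

End Mahler.

Arguments mahler_values : clear implicits.

(* Main.v *)
(** The Mahler measure of [F = sum_i c_i z^(a_i)] depends only on the c_i and on the
    lattice of relations [{n in Z^k : sum_i n_i a_i = 0}], which can be any saturated
    subgroup of Z^k containing no [e_i - e_j].  With S = sum_i |c_i| and f = F/S, expanding
    log |f| = - 1/2 sum_n (1 - |f|^2)^n / n presents [m(F)] as a decreasing limit of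
    quantities that each involve only finitely many relations.  Finitely many relations
    are also those of a one-variable polynomial over the p-th roots of unity, p a large
    prime, where integrals become finite averages.  There, multiplying by a shifted
    copy of a factor eliminates one coefficient, and induction on k bounds the mean of
    (1 - |f|^2)^n by a negative power of n |f_i|^2, uniformly in the lattice.

    Hence [m(F)] bounds the coefficients of F, and the limit is uniform for bounded
    coefficients.  Along an ultrafilter of values of m converging to x, the integer
    coefficients become constant, the relation lattices converge to a lattice L of the
    same kind, and the measure attached to L is x: the set is closed.  Jensen's inequality
    gives m >= 0.  If x = 0 were a limit of values y > 0, choose one with a lattice
    containing L.  The twists of its polynomial by the characters trivial on L have
    measures that are nonnegative and whose average is the measure attached to L; by
    recurrence a positive proportion of these twists are close to the polynomial itself
    and have measure at least y/2, so the measure attached to L is positive, a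
    contradiction. *)

Require Import Defs.
From HB Require Import structures.
From mathcomp Require Import all_boot all_order all_algebra.
From mathcomp Require Import finmap monalg complex.
From mathcomp Require Import all_classical all_reals all_analysis.
From mathcomp Require Import measurable_realfun.
From mathcomp Require Import ring lra zify.

Set Implicit Arguments.
Unset Strict Implicit.
Unset Printing Implicit Defensive.

Import Order.TTheory GRing.Theory Num.Theory.
Import numFieldNormedType.Exports.

Local Open Scope classical_set_scope.
Local Open Scope ring_scope.

(** * The modulus of complex numbers *)

Section Normc.
Variable R : realType.
Implicit Types z w : R[i].
Local Notation nm := (@Normc.normc R).

Lemma normc_ge0 z : 0 <= nm z.
Proof. by case: z => a b; exact: sqrtr_ge0. Qed.

Lemma normc_eq0 z : (nm z == 0) = (z == 0).
Proof.
apply/eqP/eqP => [|->]; first exact: Normc.eq0_normc.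
exact: Normc.normc0.
Qed.

Lemma normc_gt0 z : (0 < nm z) = (z != 0).
Proof. by rewrite lt_def normc_eq0 normc_ge0 andbT. Qed.

Lemma normcX z n : nm (z ^+ n) = nm z ^+ n.
Proof.
elim: n => [|n IH]; first by rewrite !expr0; exact: Normc.normc1.
by rewrite !exprS Normc.normcM IH.
Qed.

Lemma normcXz z (s : int) : nm (z ^ s) = nm z ^ s.
Proof.
case: s => n; first exact: normcX.
by rewrite /exprz Normc.normcV normcX.
Qed.

Lemma normc_sum (I : Type) (r : seq I) (P : pred I) (F : I -> R[i]) :
  nm (\sum_(i <- r | P i) F i) <= \sum_(i <- r | P i) nm (F i).
Proof.
elim/big_ind2: _ => [|x1 y1 x2 y2 h1 h2|//].
  by rewrite (Normc.normc0 R).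
by apply: le_trans (lerD h1 h2); exact: le_normcD.
Qed.

Lemma normc_prod (I : Type) (r : seq I) (P : pred I) (F : I -> R[i]) :
  nm (\prod_(i <- r | P i) F i) = \prod_(i <- r | P i) nm (F i).
Proof.
by elim/big_ind2: _ => [|x1 y1 x2 y2 <- <-|//]; [exact: Normc.normc1|exact: Normc.normcM].
Qed.

Lemma normcC z w : nm (z - w) = nm (w - z).
Proof. by rewrite -opprB normcN. Qed.

Lemma normc_real (x : R) : nm (x%:C)%C = `|x|.
Proof. by rewrite /= expr0n /= addr0 sqrtr_sqr. Qed.

Lemma normc_norm z : (nm z)%:C%C = `|z|.
Proof. by []. Qed.

Lemma sqr_normcE z : ((nm z ^+ 2)%:C)%C = z * (z^*)%C.
Proof. by rewrite rmorphXn /= -sqr_normc. Qed.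

Lemma le_normcB z w : nm z - nm w <= nm (z - w).
Proof. by rewrite lerBlDr -{1}(subrK w z); exact: le_normcD. Qed.

Lemma dist_normc z w : `|nm z - nm w| <= nm (z - w).
Proof.
by rewrite ler_norml le_normcB andbT lerNl opprB normcC le_normcB.
Qed.

Lemma Re_le_normc z : complex.Re z <= nm z.
Proof.
have := normc_ge_Re z; rewrite -normc_norm lecR.
exact/le_trans/ler_norm.
Qed.

Lemma conjc_unit z : nm z = 1 -> (z^*)%C = z^-1.
Proof.
move=> z1; have z0 : z != 0 by rewrite -normc_gt0 z1.
by apply: (mulfI z0); rewrite -sqr_normcE z1 expr1n mulfV.
Qed.

Lemma ReD z w : complex.Re (z + w) = complex.Re z + complex.Re w.
Proof. by case: z w => [? ?] [? ?]. Qed.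

Lemma Re_sum (I : Type) (r : seq I) (P : pred I) (F : I -> R[i]) :
  complex.Re (\sum_(i <- r | P i) F i) = \sum_(i <- r | P i) complex.Re (F i).
Proof. by elim/big_ind2: _ => [//|x1 y1 x2 y2 <- <-|//]; exact: ReD. Qed.

Lemma Re_mulr (x : R) z : complex.Re ((x%:C)%C * z) = x * complex.Re z.
Proof. by case: z => a b /=; rewrite mul0r subr0. Qed.

End Normc.

(** * Roots of unity *)

Section RootsOfUnity.
Variable R : realType.
Local Notation nm := (@Normc.normc R).

(** A root of 1 + X + ... + X^(p-1) differs from 1, where the value is p, and its order divides the
    prime p. *)
Lemma prim_root_exists p : prime p -> exists w : R[i], p.-primitive_root w.
Proof.
move=> pp; have p1 := prime_gt1 pp.
pose P : {poly R[i]} := \poly_(i < p) 1.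
have sP : size P = p by rewrite size_poly_eq ?oner_eq0.
have [w wP] : exists w, root P w by apply/closed_rootP; rewrite sP; lia.
have Pw : \sum_(i < p) w ^+ i = 0.
  have /eqP := wP; rewrite horner_poly => E; rewrite -[RHS]E.
  by apply: eq_bigr => i _; rewrite mul1r.
have wp : w ^+ p = 1.
  by apply/eqP; rewrite -subr_eq0 subrX1 Pw mulr0.
have w1 : w != 1.
  apply/eqP => w1; move: Pw; rewrite w1.
  rewrite (eq_bigr (fun _ => 1)) => [|i _]; last by rewrite expr1n.
  by rewrite sumr_const card_ord => /eqP; rewrite pnatr_eq0; lia.
have [m wm mp] := prim_order_exists (prime_gt0 pp) wp.
have /primeP[_ /(_ _ mp) /pred2P[m1|<-]] := pp; last by exists w.
move: wm; rewrite m1 => /prim_expr_order; rewrite expr1 => w1'.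
by rewrite w1' eqxx in w1.
Qed.

Lemma normc_prim_root p (w : R[i]) : p.-primitive_root w -> nm w = 1.
Proof.
move=> wp; apply/eqP; rewrite -(pexpr_eq1 (prim_order_gt0 wp)) ?normc_ge0 //.
by rewrite -normcX (prim_expr_order wp) Normc.normc1.
Qed.

Lemma prim_root_exprz p (w : R[i]) (s : int) : p.-primitive_root w ->
  (w ^ s == 1) = (p %| `|s|)%N.
Proof.
move=> wp; case: s => n; rewrite /exprz.
  by rewrite -(prim_order_dvd wp).
by rewrite invr_eq1 -(prim_order_dvd wp).
Qed.

Lemma sum_prim_root p (w : R[i]) (s : int) : p.-primitive_root w ->
  \sum_(j < p) (w ^+ j) ^ s = if (p %| `|s|)%N then p%:R else 0.
Proof.
move=> wp; rewrite -(prim_root_exprz _ wp).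
have E j : (w ^+ j) ^ s = (w ^ s) ^+ j.
  by rewrite -[w ^+ j]/(w ^ (j : int)) -[_ ^+ j]/((w ^ s) ^ (j : int)) !exprz_exp mulrC.
under eq_bigr do rewrite E.
case: eqVneq => [->|ws1].
  by under eq_bigr do rewrite expr1n; rewrite sumr_const card_ord.
have := subrX1 (w ^ s) p; rewrite -E (prim_expr_order wp) exp1rz subrr.
by move/esym/eqP; rewrite mulf_eq0 subr_eq0 (negPf ws1) => /eqP.
Qed.

(* A Poisson kernel bound: [Re (1/(1 - r z)) >= (1-r)/|1 - r z|^2], and the mean of
   [1/(1 - r z)] over the p-th roots of unity is [1/(1 - r^p)]. *)
Lemma card_near_one p (w : R[i]) (eta : R) : p.-primitive_root w ->
  0 < eta -> eta <= 1 -> (1 - eta) ^+ p <= 2^-1 ->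
  #|[pred j : 'I_p | nm (w ^+ j - 1) < eta]|%:R <= 8 * eta * p%:R.
Proof.
move=> wp eta0 eta1 hp; pose r := 1 - eta.
have w1 := normc_prim_root wp.
have r0 : 0 <= r by rewrite /r; lra.
have r1 : r < 1 by rewrite /r; lra.
pose q (j : 'I_p) : R[i] := (r%:C)%C * w ^+ j.
have nq j : nm (q j) = r.
  by rewrite /q Normc.normcM normc_real normcX w1 expr1n mulr1 ger0_norm.
have q1 j : 1 - q j != 0.
  rewrite -normc_gt0; have := le_normcB 1 (q j); rewrite Normc.normc1 nq.
  by apply: lt_le_trans; lra.
have qp j : q j ^+ p = ((r ^+ p)%:C)%C.
  by rewrite /q exprMn exprAC (prim_expr_order wp) expr1n mulr1 rmorphXn.
have rp1 : r ^+ p < 1 by apply: le_lt_trans hp _; lra.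
(* Since [q j ^+ p] is r^p for every j, the geometric series folds into its first p terms; summed
   over j, only the term n = 0 survives. *)
have S1 : \sum_j (1 - q j)^-1 = ((p%:R / (1 - r ^+ p))%:C)%C.
  have E j : (1 - q j)^-1 = (((1 - r ^+ p)^-1)%:C)%C * \sum_(n < p) q j ^+ n.
    have h : 1 - q j ^+ p != 0.
      rewrite qp -(rmorph1 (real_complex R)) -rmorphB /= -normc_gt0 normc_real.
      by rewrite normr_gt0; lra.
    apply: (mulIf (q1 j)); rewrite mulVf // -mulrA.
    have -> : (\sum_(n < p) q j ^+ n) * (1 - q j) = 1 - q j ^+ p.
      rewrite mulrC -(opprB (q j ^+ p) 1) subrX1 -[- ((_ - 1) * _)]mulNr.
      by rewrite (opprB (q j)).
    rewrite qp -(rmorph1 (real_complex R)) -rmorphB -rmorphM /= mulVf //; lra.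
  under eq_bigr do rewrite E; rewrite -mulr_sumr exchange_big /=.
  have p0 := prim_order_gt0 wp.
  have Z : \sum_(n < p | n != Ordinal p0) \sum_(i < p) q i ^+ n = 0.
    apply: big1 => n n0; rewrite /q; under eq_bigr do rewrite exprMn.
    rewrite -mulr_sumr.
    have -> : \sum_(i < p) (w ^+ i) ^+ n = \sum_(i < p) (w ^+ i) ^ (n : int) by [].
    have n1 : (0 < n)%N.
      by rewrite lt0n; apply: contra n0 => /eqP n0; apply/eqP/val_inj.
    by rewrite (sum_prim_root _ wp) absz_nat gtnNdvd ?mulr0.
  rewrite (bigD1 (Ordinal p0)) //= Z addr0 (eq_bigr (fun _ => 1)) //.
  by rewrite sumr_const card_ord -(rmorph_nat (real_complex R)) -rmorphM /= mulrC.
have RS : \sum_j complex.Re (1 - q j)^-1 = p%:R / (1 - r ^+ p).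
  by rewrite -Re_sum S1.
have L j : (1 - r) / nm (1 - q j) ^+ 2 <= complex.Re (1 - q j)^-1.
  have n2 : 0 < nm (1 - q j) ^+ 2 by rewrite exprn_gt0 // normc_gt0.
  rewrite ler_pdivrMr //.
  have -> : complex.Re (1 - q j)^-1 * nm (1 - q j) ^+ 2 = complex.Re (1 - q j).
    have : (1 - q j)^-1 * ((nm (1 - q j) ^+ 2)%:C)%C = ((1 - q j)^*)%C.
      by rewrite sqr_normcE mulKf.
    move=> /(congr1 (@complex.Re R)); rewrite mulrC Re_mulr mulrC => ->.
    by case: (1 - q j).
  have -> : complex.Re (1 - q j) = 1 - complex.Re (q j) by case: (q j).
  by have := Re_le_normc (q j); rewrite nq; lra.
(* A root near 1 has |1 - q_j| <= 2 eta, so it contributes at least eta / (2 eta)^2 to a sum that is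
   at most 2p. *)
have near (j : 'I_p) : nm (w ^+ j - 1) < eta -> (4 * eta)^-1 <= complex.Re (1 - q j)^-1.
  move=> wj; apply: le_trans (L j).
  have n0 : 0 < nm (1 - q j) by rewrite normc_gt0.
  have : nm (1 - q j) <= 2 * eta.
    have -> : 1 - q j = (1 - w ^+ j) + ((eta%:C)%C * w ^+ j).
      rewrite /q /r rmorphB /= rmorph1; ring.
    apply: le_trans (le_normcD _ _) _.
    rewrite Normc.normcM normc_real normcX w1 expr1n mulr1 gtr0_norm // normcC; lra.
  move=> h; rewrite invf_ple ?posrE ?divr_gt0 ?exprn_gt0 //; try lra.
  rewrite invf_div ler_pdivrMr; last by lra.
  rewrite /r; nra.
have pos (j : 'I_p) : 0 <= complex.Re (1 - q j)^-1.
  by apply: le_trans (L j); rewrite divr_ge0 ?sqr_ge0 //; lra.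
have : (4 * eta)^-1 * #|[pred j : 'I_p | nm (w ^+ j - 1) < eta]|%:R
     <= p%:R / (1 - r ^+ p).
  rewrite -RS (bigID (fun j : 'I_p => nm (w ^+ j - 1) < eta)) /=.
  rewrite -[leLHS]addr0 lerD //; last by apply: sumr_ge0 => j _.
  rewrite mulr_natr -sumr_const big_mkcond /= [leRHS]big_mkcond /=.
  apply: ler_sum => j _; rewrite inE; case: ifP => // ; exact: near.
rewrite ler_pdivrMl; last by lra.
move=> /le_trans; apply.
have -> : 8 * eta * p%:R = 4 * eta * (p%:R * 2) by ring.
apply: ler_wpM2l; first lra.
apply: ler_wpM2l => //.
rewrite invf_ple ?posrE; lra.
Qed.

End RootsOfUnity.

(** * Means of powers of 1 - |f|^2 *)

Section DefectMean.
Variables (R : realType) (k : nat).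
Implicit Types (c : 'I_k -> R[i]) (r : pred 'rV[int]_k) (b : 'I_k -> int).
Local Notation nm := (@Normc.normc R).
Local Notation idx := (option ('I_k * 'I_k)).

(** The terms of 1 - |F|^2: [None] is the constant 1, and [Some (i, j)] is - c_i conj(c_j) z^(a_i -
    a_j), whose exponent is recorded formally as e_i - e_j. A function [s] into [idx] then picks one
    term of the expanded n-th power. *)
Definition term_vec (o : idx) : 'rV[int]_k :=
  if o is Some q then delta_mx 0 q.1 - delta_mx 0 q.2 else 0.

Definition exp_vec n (s : {ffun 'I_n -> idx}) : 'rV[int]_k :=
  \sum_(i < n) term_vec (s i).

Definition term_coef c (o : idx) : R[i] :=
  if o is Some q then - (c q.1 * (c q.2)^*%C) else 1.

(* If [r v] says that the exponent vectors a_1, .., a_k satisfy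
   [sum_i v_i a_i = 0], this is the mean over the torus of [(1 - |F|^2)^n] for
   [F = sum_i c_i z^(a_i)]. *)
Definition defect_mean c r n : R :=
  complex.Re (\sum_(s : {ffun 'I_n -> idx})
    (r (exp_vec s))%:R * \prod_(i < n) term_coef c (s i)).

Definition dotz b (v : 'rV[int]_k) : int := \sum_i v 0 i * b i.

Definition twist c b (z : R[i]) (i : 'I_k) : R[i] := c i * z ^ b i.

Definition l1norm c : R := \sum_i nm (c i).

(* Up to order N, the relation lattice [r] is that of the characters
   [j |-> w^(j b_i)] of Z/p. *)
Definition models r b p N := forall n, (n <= N)%N ->
  forall s : {ffun 'I_n -> idx}, r (exp_vec s) = (p %| `|dotz b (exp_vec s)|)%N.

(** The exponents b may depend on N, but all large primes must serve: later estimates carry an error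
    that vanishes only as p grows. *)
Definition approximable r := forall N, exists b, exists p0,
  forall p, (p0 <= p)%N -> prime p -> models r b p N.

Lemma dotz_sum b (I : Type) (t : seq I) (F : I -> 'rV[int]_k) :
  dotz b (\sum_(i <- t) F i) = \sum_(i <- t) dotz b (F i).
Proof.
rewrite /dotz exchange_big /=; apply: eq_bigr => i _.
by rewrite summxE mulr_suml.
Qed.

Lemma dotz_term b (q : 'I_k * 'I_k) : dotz b (term_vec (Some q)) = b q.1 - b q.2.
Proof.
have D (i : 'I_k) : \sum_j (delta_mx 0 i : 'rV[int]_k) 0 j * b j = b i.
  rewrite (bigD1 i) //= big1 ?addr0 ?mxE ?eqxx ?mul1r // => j ji.
  by rewrite mxE eqxx /= (negPf ji) mul0r.
rewrite -(D q.1) -(D q.2) -sumrB; apply: eq_bigr => j _.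
by rewrite /term_vec !mxE mulrBl.
Qed.

Lemma dotz0 b : dotz b 0 = 0.
Proof. by rewrite /dotz big1 // => i _; rewrite mxE mul0r. Qed.

Lemma term_coef_twist c b z o : nm z = 1 ->
  term_coef (twist c b z) o = term_coef c o * z ^ dotz b (term_vec o).
Proof.
move=> z1; have z0 : z != 0 by rewrite -normc_gt0 z1.
case: o => [q|]; last by rewrite /= dotz0 expr0z mulr1.
rewrite dotz_term /= /twist mulNr rmorphM /= (conjc_unit (_ : nm (z ^ b q.2) = 1)).
  by rewrite invr_expz expfzDr //; congr (- _); ring.
by rewrite normcXz z1 exp1rz.
Qed.

Lemma prod_term_coef_twist c b z n (s : {ffun 'I_n -> idx}) : nm z = 1 ->
  \prod_i term_coef (twist c b z) (s i) =
  (\prod_i term_coef c (s i)) * z ^ dotz b (exp_vec s).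
Proof.
move=> z1; have z0 : z != 0 by rewrite -normc_gt0 z1.
under eq_bigr do rewrite term_coef_twist //.
rewrite big_split /= dotz_sum; congr (_ * _).
by elim/big_rec2: _ => [|i x y _ ->]; rewrite ?expr0z // expfzDr.
Qed.

Lemma defect_expand c n :
  (((1 - nm (\sum_i c i) ^+ 2) ^+ n)%:C)%C =
  \sum_(s : {ffun 'I_n -> idx}) \prod_(i < n) term_coef c (s i).
Proof.
have -> : (((1 - nm (\sum_i c i) ^+ 2) ^+ n)%:C)%C =
          \prod_(i < n) \sum_(o : idx) term_coef c o.
  rewrite prodr_const card_ord rmorphXn; congr (_ ^+ _).
  rewrite rmorphB rmorph1 /= sqr_normcE rmorph_sum /=.
  rewrite (bigD1 None) //=; congr (_ + _).
  rewrite big_distrlr pair_big /= -sumrN.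
  rewrite (reindex_omap Some id) /=; first by apply: eq_bigl => q; rewrite eqxx.
  by case.
by rewrite bigA_distr_bigA.
Qed.

Lemma defect_mean_predT c n :
  defect_mean c predT n = (1 - nm (\sum_i c i) ^+ 2) ^+ n.
Proof.
rewrite /defect_mean; under eq_bigr do rewrite mul1r.
by rewrite -defect_expand.
Qed.

Lemma eq_defect_mean c r r' n :
  (forall s : {ffun 'I_n -> idx}, r (exp_vec s) = r' (exp_vec s)) ->
  defect_mean c r n = defect_mean c r' n.
Proof. by move=> E; congr complex.Re; apply: eq_bigr => s _; rewrite E. Qed.

(** Orthogonality of the characters of Z/p: averaging over j keeps exactly the exponent vectors
    whose product with b is divisible by p. With [r] equal to [predT] this turns a mean over the
    torus into a finite average; other [r] serve to compare two lattices. *)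
Lemma defect_mean_twist_avg c b r r' n p w : p.-primitive_root w ->
  (forall s : {ffun 'I_n -> idx},
     r' (exp_vec s) = r (exp_vec s) && (p %| `|dotz b (exp_vec s)|)%N) ->
  defect_mean c r' n = p%:R^-1 * \sum_(j < p) defect_mean (twist c b (w ^+ j)) r n.
Proof.
move=> wp E; have p0 : p%:R != 0 :> R by rewrite pnatr_eq0 -lt0n (prim_order_gt0 wp).
apply: (mulfI p0); rewrite mulVKf // -Re_sum exchange_big /=.
rewrite -[p%:R in LHS]/(complex.Re ((p%:R)%:C)%C) -Re_mulr rmorph_nat mulr_sumr.
congr complex.Re; apply: eq_bigr => s _.
have w1 j : nm (w ^+ j) = 1 by rewrite normcX (normc_prim_root wp) expr1n.
under eq_bigr do rewrite (prod_term_coef_twist _ _ _ (w1 _)).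
rewrite -!mulr_sumr (sum_prim_root _ wp) E.
case: (r _); last by rewrite !mul0r mulr0.
by case: ifP => _ /=; rewrite ?(mulr0, mul0r, mul1r) // mulrC.
Qed.

Lemma defect_mean_avg c b r N n p w : p.-primitive_root w -> models r b p N ->
  (n <= N)%N ->
  defect_mean c r n =
  p%:R^-1 * \sum_(j < p) (1 - nm (\sum_i twist c b (w ^+ j) i) ^+ 2) ^+ n.
Proof.
move=> wp M nN; rewrite (@defect_mean_twist_avg c b predT r n p w) //.
  by under eq_bigr do rewrite defect_mean_predT.
by move=> s; rewrite M.
Qed.

Lemma l1norm_twist c b z : nm z = 1 -> l1norm (twist c b z) = l1norm c.
Proof.
move=> z1; apply: eq_bigr => i _.
by rewrite Normc.normcM normcXz z1 exp1rz mulr1.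
Qed.

Lemma defect_ge0 c : l1norm c <= 1 -> 0 <= 1 - nm (\sum_i c i) ^+ 2.
Proof.
move=> c1; rewrite subr_ge0 expr_le1 ?normc_ge0 //.
exact: le_trans (normc_sum _ _ _) c1.
Qed.

Lemma defect_le1 c : 1 - nm (\sum_i c i) ^+ 2 <= 1.
Proof. by rewrite gerBl sqr_ge0. Qed.

Section Approximable.
Variable r : pred 'rV[int]_k.
Hypothesis rA : approximable r.

Lemma approximableP N p0 : exists b p w,
  [/\ (p0 <= p)%N, prime p, p.-primitive_root (w : R[i]) & models r b p N].
Proof.
have [b [p1 H]] := rA N; have [p pp Pp] := prime_above (maxn p0 p1).
have [w wp] := prim_root_exists R Pp.
exists b, p, w; split => //; first lia.
by apply: H => //; lia.
Qed.

Lemma defect_mean_ge0 c n : l1norm c <= 1 -> 0 <= defect_mean c r n.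
Proof.
move=> c1; have [b [p [w [_ _ wp M]]]] := approximableP n 0.
rewrite (defect_mean_avg _ wp M (leqnn n)) mulr_ge0 ?invr_ge0 //.
apply: sumr_ge0 => j _; rewrite exprn_ge0 // defect_ge0 // l1norm_twist //.
by rewrite normcX (normc_prim_root wp) expr1n.
Qed.

Lemma defect_mean_le1 c n : l1norm c <= 1 -> defect_mean c r n <= 1.
Proof.
move=> c1; have [b [p [w [_ Pp wp M]]]] := approximableP n 0.
have p0 : 0 < p%:R :> R by rewrite ltr0n prime_gt0.
rewrite (defect_mean_avg _ wp M (leqnn n)) ler_pdivrMl // mulr1.
rewrite -[p in leRHS]card_ord -sumr_const; apply: ler_sum => j _.
rewrite exprn_ile1 ?defect_le1 // defect_ge0 // l1norm_twist //.
by rewrite normcX (normc_prim_root wp) expr1n.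
Qed.

Lemma ler_dist_expn (x y : R) n : 0 <= x <= 1 -> 0 <= y <= 1 ->
  `|x ^+ n - y ^+ n| <= n%:R * `|x - y|.
Proof.
move=> /andP[x0 x1] /andP[y0 y1].
rewrite subrXX normrM mulrC; apply: ler_wpM2r => //.
apply: le_trans (ler_norm_sum _ _ _) _.
rewrite -[n in leRHS]card_ord -sumr_const; apply: ler_sum => i _.
by rewrite ger0_norm ?mulr_ge0 ?exprn_ge0 // mulr_ile1 ?exprn_ge0 ?exprn_ile1.
Qed.

(** On the finite model both moduli are at most 1, so n-th powers are n-Lipschitz and |g|^2 - |f|^2
    = (|g| - |f|)(|g| + |f|) costs a factor 2. *)
Lemma defect_mean_lipschitz c c' n : l1norm c <= 1 -> l1norm c' <= 1 ->
  `|defect_mean c r n - defect_mean c' r n| <=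
  2 * n%:R * \sum_i nm (c i - c' i).
Proof.
move=> c1 c1'; have [b [p [w [_ Pp wp M]]]] := approximableP n 0.
have p0 : 0 < p%:R :> R by rewrite ltr0n prime_gt0.
have w1 (j : nat) : nm (w ^+ j) = 1 by rewrite normcX (normc_prim_root wp) expr1n.
rewrite !(defect_mean_avg _ wp M (leqnn n)) -mulrBr normrM gtr0_norm ?invr_gt0 //.
rewrite ler_pdivrMl // -sumrB; apply: le_trans (ler_norm_sum _ _ _) _.
set D := 2 * _ * _; rewrite [leRHS]mulr_natl -[p in leRHS]card_ord -sumr_const.
apply: ler_sum => j _.
set f := \sum_i twist c b _ i; set g := \sum_i twist c' b _ i.
have f1 : nm f <= 1.
  by apply: le_trans (normc_sum _ _ _) _; rewrite -/(l1norm _) l1norm_twist.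
have g1 : nm g <= 1.
  by apply: le_trans (normc_sum _ _ _) _; rewrite -/(l1norm _) l1norm_twist.
have f0 := normc_ge0 f; have g0 := normc_ge0 g.
apply: le_trans (ler_dist_expn _ _ _) _; [by apply/andP; split; nra..|].
have -> : 1 - nm f ^+ 2 - (1 - nm g ^+ 2) = (nm g - nm f) * (nm g + nm f) by ring.
have -> : D = n%:R * (2 * \sum_i nm (c i - c' i)) by rewrite /D; ring.
rewrite normrM; apply: ler_wpM2l => //.
rewrite mulrC; apply: ler_pM => //; first by rewrite ger0_norm; nra.
rewrite distrC; apply: le_trans (dist_normc _ _) _; rewrite -sumrB.
apply: le_trans (normc_sum _ _ _) _; apply: ler_sum => i _.
by rewrite /twist -mulrBl Normc.normcM normcXz w1 exp1rz mulr1.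
Qed.

End Approximable.
End DefectMean.

(** * Uniform decay of the means of (1 - |F|^2)^n *)

Section Tail.
Variables (R : realType) (k : nat).
Implicit Types (c : 'I_k -> R[i]) (r : pred 'rV[int]_k) (b : 'I_k -> int).
Local Notation nm := (@Normc.normc R).

(** The k exponent vectors are pairwise different, so no two monomials merge. *)
Definition distinct r :=
  forall i j : 'I_k, i != j -> ~~ r (delta_mx 0 i - delta_mx 0 j).

(** For f(t) = sum_i c_i t^(b_i), these are the coefficients of (f(zt) - z^(b_i1) f(t)) / 2. The one
    at [i1] vanishes, and halving keeps the l1 norm at most that of [c] when |z| = 1. *)
Definition shift_diff c b i1 (z : R[i]) (i : 'I_k) : R[i] :=
  c i * (z ^ b i - z ^ b i1) / 2.

Lemma l1norm_shift_diff c b i1 z : nm z = 1 -> l1norm (shift_diff c b i1 z) <= l1norm c.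
Proof.
move=> z1; apply: ler_sum => i _; rewrite /shift_diff !Normc.normcM Normc.normcV.
have -> : nm 2 = 2 :> R by rewrite -(rmorph_nat (real_complex R)) normc_real ger0_norm.
rewrite -mulrA; apply: ler_piMr; first exact: normc_ge0.
rewrite ler_pdivrMr // mul1r; apply: le_trans (le_normcD _ _) _.
by rewrite normcN !normcXz z1 !exp1rz.
Qed.

(** With F = |f|^2 and G = |g|^2, the arithmetic-geometric inequality gives (1 - F)(1 - G) <= (1 -
    (F + G)/2)^2, and convexity of the square gives |(g - u f)/2|^2 <= (F + G)/2. *)
Lemma defect_mul_le (f g u : R[i]) n : nm f <= 1 -> nm g <= 1 -> nm u = 1 ->
  (1 - nm f ^+ 2) ^+ n * (1 - nm g ^+ 2) ^+ n <=
  (1 - nm ((g - u * f) / 2) ^+ 2) ^+ (2 * n).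
Proof.
move=> f1 g1 u1; have f0 := normc_ge0 f; have g0 := normc_ge0 g.
have : nm ((g - u * f) / 2) <= (nm f + nm g) / 2.
  rewrite Normc.normcM Normc.normcV.
  have -> : nm 2 = 2 :> R by rewrite -(rmorph_nat (real_complex R)) normc_real ger0_norm.
  rewrite ler_pM2r // addrC; apply: le_trans (le_normcD _ _) _.
  by rewrite normcN Normc.normcM u1 mul1r.
move: (nm _) (normc_ge0 ((g - u * f) / 2)) => x x0 hx.
rewrite -exprMn exprM; apply: lerXn2r; rewrite ?nnegrE ?sqr_ge0 //.
  by rewrite mulr_ge0 // subr_ge0 expr_le1.
have hx2 : x ^+ 2 <= (nm f ^+ 2 + nm g ^+ 2) / 2.
  have : 0 <= (nm f - nm g) ^+ 2 by exact: sqr_ge0.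
  rewrite sqrrB => h; apply: le_trans (_ : ((nm f + nm g) / 2) ^+ 2 <= _).
    by apply: lerXn2r; rewrite ?nnegrE //; lra.
  by rewrite expr_div_n sqrrD; lra.
have : nm f ^+ 2 <= 1 by rewrite expr_le1.
have : nm g ^+ 2 <= 1 by rewrite expr_le1.
have := sqr_ge0 (nm f); have := sqr_ge0 (nm g).
move: (nm f ^+ 2) (nm g ^+ 2) (x ^+ 2) hx2 => F G X hX G0 F0 G1 F1.
apply: le_trans (_ : (1 - (F + G) / 2) ^+ 2 <= _).
  rewrite -subr_ge0.
  have -> : (1 - (F + G) / 2) ^+ 2 - (1 - F) * (1 - G) = ((F - G) / 2) ^+ 2 by field.
  exact: sqr_ge0.
by apply: lerXn2r; rewrite ?nnegrE; lra.
Qed.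

Lemma sum_mod_shift p (F : nat -> R) j : (0 < p)%N ->
  (forall l, F (l %% p)%N = F l) -> \sum_(l < p) F l = \sum_(s < p) F (j + s)%N.
Proof.
move=> p0 FE; pose h (s : 'I_p) := Ordinal (ltn_pmod (j + s) p0).
have hi : injective h.
  move=> s t /(congr1 val) /= /eqP; rewrite eqn_modDl !modn_small // => /eqP.
  exact: val_inj.
by rewrite (reindex_inj hi) /=; apply: eq_bigr => s _; rewrite FE.
Qed.

(** The square of a mean over Z/p is a double mean over pairs (j, j + s). For fixed s,
    [defect_mul_le] replaces each product by a single power for the shifted difference. *)
Lemma defect_mean_sqr c r b p w n i1 : l1norm c <= 1 ->
  prime p -> p.-primitive_root w -> models r b p (2 * n) ->
  defect_mean c r n ^+ 2 <=
  p%:R^-1 * \sum_(s < p) defect_mean (shift_diff c b i1 (w ^+ s)) r (2 * n).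
Proof.
move=> c1 Pp wp M; have p0 : 0 < p%:R :> R by rewrite ltr0n prime_gt0.
have w1 (j : nat) : nm (w ^+ j) = 1 by rewrite normcX (normc_prim_root wp) expr1n.
pose f (j : nat) := \sum_i twist c b (w ^+ j) i.
have f1 j : nm (f j) <= 1.
  by apply: le_trans (normc_sum _ _ _) _; rewrite -/(l1norm _) l1norm_twist.
pose X j := (1 - nm (f j) ^+ 2) ^+ n.
have XE l : X (l %% p)%N = X l by rewrite /X /f (prim_expr_mod wp).
rewrite (defect_mean_avg _ wp M) ?leq_pmull // -/(f _) exprMn expr2 -mulrA.
rewrite ler_pM2l ?invr_gt0 // ler_pdivrMl //.
rewrite expr2 mulr_suml; under eq_bigr do rewrite mulr_sumr.
have -> : \sum_(j < p) \sum_(l < p) X j * X l =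
          \sum_(j < p) \sum_(s < p) X j * X (j + s)%N.
  apply: eq_bigr => j _; rewrite -!mulr_sumr; congr (_ * _).
  by apply: sum_mod_shift; rewrite ?prime_gt0.
rewrite exchange_big mulr_sumr /=; apply: ler_sum => s _.
rewrite (defect_mean_avg _ wp M) // mulVKf ?gt_eqF //.
apply: ler_sum => j _.
apply: le_trans (defect_mul_le n (f1 j) (f1 (j + s)%N) (_ : nm ((w ^+ s) ^ b i1) = 1)) _.
  by rewrite normcXz w1 exp1rz.
rewrite le_eqVlt; apply/orP; left; apply/eqP; congr ((1 - nm _ ^+ 2) ^+ _).
rewrite /f mulr_sumr -sumrB mulr_suml; apply: eq_bigr => i _.
rewrite /twist /shift_diff exprD exprMz_comm; first by field.
- by rewrite unitfE -normc_gt0 w1.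
- by rewrite unitfE -normc_gt0 w1.
- exact: mulrC.
Qed.

Lemma single_defect_le (y : R) n : 0 <= y <= 1 -> (1 - y) ^+ n * (1 + n%:R * y) <= 1.
Proof.
move=> /andP[y0 y1]; elim: n => [|n IH]; first by rewrite mul0r addr0 expr0 mulr1.
apply: le_trans IH; rewrite exprSr -mulrA; apply: ler_wpM2l.
  by rewrite exprn_ge0 // subr_ge0.
by rewrite -natr1; have : 0 <= n%:R :> R by []; nra.
Qed.

Lemma exists_expr_le_half (y : R) : 0 <= y < 1 ->
  exists p0, forall p, (p0 <= p)%N -> y ^+ p <= 2^-1.
Proof.
move=> /andP[y0 y1].
have : `|y| < 1 by rewrite ger0_norm.
move=> /cvg_expr /cvgrPdist_le /(_ 2^-1) [] // N _ H.
exists N => p Np; have := H p Np; rewrite /= sub0r normrN.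
by apply: le_trans; exact: ler_norm.
Qed.

(** One factor contributes e_i - e_j and the others the constant 1. Hence a model of any positive
    order already sees that the exponents are distinct. *)
Lemma shift_term_vec (i j : 'I_k) n : (0 < n)%N ->
  exists s : {ffun 'I_n -> option ('I_k * 'I_k)},
    exp_vec s = delta_mx 0 i - delta_mx 0 j.
Proof.
move=> n0; exists [ffun l : 'I_n => if val l == 0%N then Some (i, j) else None].
rewrite /exp_vec (bigD1 (Ordinal n0)) //= ffunE /= big1 ?addr0 // => l l0.
by rewrite ffunE ifF //; apply: contraNF l0 => /eqP l0; apply/eqP/val_inj.
Qed.

Lemma models_distinct r b p N : distinct r -> models r b p N -> (0 < N)%N ->
  forall i j, i != j -> ~~ (p %| `|b i - b j|)%N.
Proof.
move=> rD M N0 i j ij; have [s sE] := shift_term_vec i j N0.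
have := M N (leqnn N) s; rewrite sE => E.
by have := dotz_term b (i, j); rewrite /= => <-; rewrite -E rD.
Qed.

Lemma prim_root_exprz_prime p (w : R[i]) (s : int) : prime p ->
  p.-primitive_root w -> ~~ (p %| `|s|)%N -> p.-primitive_root (w ^ s).
Proof.
move=> Pp wp ps; have p0 := prime_gt0 Pp.
have h : (w ^ s) ^+ p = 1.
  rewrite -[_ ^+ p]/((w ^ s) ^ (p : int)) exprz_exp mulrC -exprz_exp.
  by rewrite -[w ^ (p : int)]/(w ^+ p) (prim_expr_order wp) exp1rz.
have [m wm mp] := prim_order_exists p0 h.
have /primeP[_ /(_ _ mp) /pred2P[m1|<-//]] := Pp.
move: wm; rewrite m1 => /prim_expr_order; rewrite expr1 => /eqP.
by rewrite (prim_root_exprz _ wp) (negPf ps).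
Qed.

Lemma defect_mean_single r c i0 n : approximable r -> l1norm c <= 1 ->
  (forall i, i != i0 -> c i = 0) -> defect_mean c r n = (1 - nm (c i0) ^+ 2) ^+ n.
Proof.
move=> rA c1 ci0; have [b [p [w [_ Pp wp M]]]] := approximableP R rA n 0.
have p0 : p%:R != 0 :> R by rewrite pnatr_eq0 -lt0n prime_gt0.
rewrite (defect_mean_avg _ wp M) //; apply: (mulfI p0); rewrite mulVKf //.
rewrite mulr_natl -[p in RHS]card_ord -sumr_const; apply: eq_bigr => j _.
rewrite (bigD1 i0) //= big1 ?addr0 => [|i ii0]; last by rewrite /twist ci0 ?mul0r.
by rewrite /twist Normc.normcM normcXz normcX (normc_prim_root wp) expr1n exp1rz mulr1.
Qed.

(* Squaring the mean over Z/p and shifting one factor kills one coefficient; the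
   other coefficients stay bounded below except for a small proportion of shifts. *)
Lemma defect_mean_step K delta d r c (D : {set 'I_k}) i0 i1 n (eta : R) :
  (forall c' (D' : {set 'I_k}) m, l1norm c' <= 1 ->
    (#|D'| <= d)%N -> (forall i, i \notin D' -> c' i = 0) -> c' i0 != 0 -> (0 < m)%N ->
    defect_mean c' r m <= K * expR (- (delta * ln (m%:R * nm (c' i0) ^+ 2)))) ->
  0 <= K -> 0 <= delta ->
  approximable r -> distinct r -> l1norm c <= 1 ->
  (#|D| <= d.+1)%N -> (forall i, i \notin D -> c i = 0) -> c i0 != 0 -> (0 < n)%N ->
  i1 \in D -> i1 != i0 -> 0 < eta -> eta <= 1 ->
  defect_mean c r n ^+ 2 <=
  8 * eta + K * expR (- (delta * ln (n%:R * nm (c i0) ^+ 2 * eta ^+ 2 / 2))).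
Proof.
move=> IH K0 d0 rA rD c1 Dd cD ci0 n0 i1D i10 e0 e1.
have h0 : 0 < nm (c i0) by rewrite normc_gt0.
have n0' : 0 < n%:R :> R by rewrite ltr0n.
(* The prime must be large for [card_near_one], which bounds the proportion of bad shifts by 8
   eta. *)
have [N HN] : exists p0, forall p, (p0 <= p)%N -> (1 - eta) ^+ p <= 2^-1.
  by apply: exists_expr_le_half; lra.
have [b [p [w [Np Pp wp M]]]] := approximableP R rA (2 * n) N.
have p0 : 0 < p%:R :> R by rewrite ltr0n prime_gt0.
have w1 (j : nat) : nm (w ^+ j) = 1 by rewrite normcX (normc_prim_root wp) expr1n.
apply: le_trans (defect_mean_sqr i1 c1 Pp wp M) _.
rewrite ler_pdivrMl //; set B := K * _.
have B0 : 0 <= B by rewrite mulr_ge0 // expR_ge0.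
have bd : ~~ (p %| `|b i0 - b i1|)%N.
  by apply: (models_distinct rD M); [rewrite muln_gt0|rewrite eq_sym].
pose w' := w ^ (b i0 - b i1).
have wp' : p.-primitive_root w' by exact: prim_root_exprz_prime.
have cs1 (s : nat) : l1norm (shift_diff c b i1 (w ^+ s)) <= 1.
  exact: le_trans (l1norm_shift_diff _ _ _ _) c1.
have w'E (s : nat) : nm ((w ^+ s) ^ b i0 - (w ^+ s) ^ b i1) = nm (w' ^+ s - 1).
  have u0 : w ^+ s != 0 by rewrite -normc_gt0 w1.
  have -> : w' ^+ s = (w ^+ s) ^ (b i0 - b i1).
    rewrite /w' -[_ ^+ s]/((w ^ (b i0 - b i1)) ^ (s : int)) exprz_exp mulrC.
    by rewrite -exprz_exp.
  rewrite -[RHS]mulr1 -(exp1rz R (b i1)) -[in RHS](w1 s) -normcXz -Normc.normcM.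
  by rewrite mulrBl mul1r -expfzDr // subrK.
(* Bad shifts, with w'^s within eta of 1, get the trivial bound 1; for the others the coefficient at
   [i0] keeps modulus at least |c_i0| eta / 2, and the induction hypothesis applies. *)
have H : \sum_(s < p) defect_mean (shift_diff c b i1 (w ^+ s)) r (2 * n) <=
    \sum_(s < p) ((nm (w' ^+ s - 1) < eta)%R%:R + B).
  apply: ler_sum => s _; case: ltP => hs.
    by apply: le_trans (defect_mean_le1 rA _ (cs1 s)) _; rewrite lerDl.
  rewrite add0r.
  have hE : nm (shift_diff c b i1 (w ^+ s) i0) = nm (c i0) * nm (w' ^+ s - 1) / 2.
    rewrite /shift_diff !Normc.normcM Normc.normcV w'E; congr (_ / _).
    by rewrite -(rmorph_nat (real_complex R)) normc_real ger0_norm.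
  have hs0 : 0 < nm (shift_diff c b i1 (w ^+ s) i0).
    by rewrite hE divr_gt0 // mulr_gt0 //; apply: lt_le_trans hs.
  apply: le_trans (IH _ (D :\ i1) (2 * n)%N (cs1 s) _ _ _ _) _.
  - by move: Dd; rewrite (cardsD1 i1 D) i1D.
  - move=> i; rewrite !inE negb_and negbK => /orP[/eqP ->|iD].
      by rewrite /shift_diff subrr mulr0 mul0r.
    by rewrite /shift_diff (cD i iD) !mul0r.
  - by rewrite -normc_gt0.
  - by rewrite muln_gt0.
  apply: ler_wpM2l => //; rewrite ler_expR lerN2; apply: ler_wpM2l => //.
  rewrite ler_ln ?posrE; last first.
  - by rewrite mulr_gt0 ?exprn_gt0 // ltr0n muln_gt0.
  - by rewrite !mulr_gt0 ?exprn_gt0.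
  rewrite hE natrM !exprMn.
  have : eta ^+ 2 <= nm (w' ^+ s - 1) ^+ 2 by apply: lerXn2r; rewrite ?nnegrE //; lra.
  have : 0 < nm (c i0) ^+ 2 by rewrite exprn_gt0.
  move: (nm (c i0) ^+ 2) (nm (w' ^+ s - 1) ^+ 2) (eta ^+ 2) => H G E H0 EG.
  have -> : 2 * n%:R * (H * G * 2^-1 ^+ 2) = n%:R * H * G / 2 by field.
  by rewrite ler_pM2r // ler_pM2l // mulr_gt0.
apply: le_trans H _; rewrite big_split /= sumr_const card_ord -(mulr_natl B) mulrDr lerD // .
have := card_near_one wp' e0 e1 (HN _ Np).
rewrite -sum1_card natr_sum big_mkcond /= => near1; rewrite [leRHS]mulrC.
apply: le_trans near1; apply: ler_sum => s _; rewrite inE.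
by case: ifP.
Qed.

Lemma expR1_le4 : expR 1 <= 4 :> R.
Proof.
have -> : expR 1 = expR (1 / 2) * expR (1 / 2) :> R.
  by rewrite -expRD; congr expR; field.
have h : 1 / 2 <= (expR (1 / 2))^-1 :> R.
  by rewrite -expRN; have := expR_ge1Dx (- (1 / 2) : R); lra.
have x0 := expR_gt0 (1 / 2 : R); move: (expR _) x0 h => x x0 h.
have x2 : x <= 2 by have : x * x^-1 = 1 by [rewrite mulfV ?gt_eqF]; nra.
nra.
Qed.

(** Induction on the size of a set carrying the coefficients. The bound is K X^(-delta) with X = n
    |c_i0|^2; [K] and [delta] depend on neither [c] nor [r], which gives all later uniformity. *)
Lemma defect_mean_tail (d : nat) : exists K delta : R,
  [/\ 1 <= K, 0 < delta, delta <= 1 & forall r c (D : {set 'I_k}) i0 n,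
    approximable r -> distinct r -> l1norm c <= 1 ->
    (#|D| <= d)%N -> (forall i, i \notin D -> c i = 0) -> c i0 != 0 -> (0 < n)%N ->
    defect_mean c r n <= K * expR (- (delta * ln (n%:R * nm (c i0) ^+ 2)))].
Proof.
elim: d => [|d [K [delta [K1 d0 d1 IH]]]].
  exists 1, 1; split => // r c D i0 n _ _ _ D0 cD ci0.
  by rewrite cD ?eqxx // in ci0; move: D0; rewrite leqn0 cards_eq0 => /eqP ->; rewrite inE.
exists (9 + 2 * K), (delta / 8); split; [lra|lra|lra|].
have d8 : 0 <= delta / 8 by lra.
move=> r c D i0 n rA rD c1 Dd cD ci0 n0.
have h0 : 0 < nm (c i0) by rewrite normc_gt0.
have n0' : 0 < n%:R :> R by rewrite ltr0n.
set X := n%:R * _.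
have X0 : 0 < X by rewrite mulr_gt0 // exprn_gt0.
have XE : X = expR (ln X) by rewrite lnK.
set t := ln X in XE *.
(* For X <= 1 the claimed bound is at least 1 and holds trivially. *)
case: (lerP t 0) => [t0|t0].
  apply: le_trans (defect_mean_le1 rA _ c1) _.
  have : 1 <= expR (- (delta / 8 * t)).
    by rewrite -[leLHS]expR0 ler_expR oppr_ge0 mulr_ge0_le0.
  move: (expR _) => E E1; apply: (le_trans E1); rewrite ler_peMl //; lra.
have A0 := defect_mean_ge0 rA n c1.
have [/existsP[i1 /andP[i1D i10]]|D1] := boolP [exists i1, (i1 \in D) && (i1 != i0)].
  (* With eta = X^(-1/4), the terms 8 eta and K (X eta^2 / 2)^(-delta) of the squared estimate are
     both O(X^(-delta/4)). The square root then yields the exponent delta / 8. *)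
  pose eta := expR (- t / 4).
  have e0 : 0 < eta := expR_gt0 _.
  have e1 : eta <= 1 by rewrite -[leRHS]expR0 ler_expR; lra.
  have IH' c' (D' : {set 'I_k}) m : l1norm c' <= 1 ->
      (#|D'| <= d)%N -> (forall i, i \notin D' -> c' i = 0) -> c' i0 != 0 -> (0 < m)%N ->
      defect_mean c' r m <= K * expR (- (delta * ln (m%:R * nm (c' i0) ^+ 2))).
    by move=> *; exact: (IH r c' D').
  have := defect_mean_step IH' (ltW (lt_le_trans ltr01 K1)) (ltW d0) rA rD c1 Dd cD ci0 n0 i1D i10 e0 e1.
  rewrite -/X XE /eta -expRM_natl -expRD ln_div ?posrE ?expR_gt0 // expRK.
  have -> : t + 2 * (- t / 4) = t / 2 by field.
  have ln2 : ln 2 <= 1 :> R.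
    rewrite -[leRHS](expRK 1) ler_ln ?posrE ?expR_gt0 //.
    by have := expR_ge1Dx (1 : R); lra.
  set u := expR (- (delta / 8 * t)).
  have u0 : 0 < u := expR_gt0 _.
  have u2 : u ^+ 2 = expR (- (delta / 4 * t)).
    by rewrite -expRM_natl; congr expR; field.
  have dt : delta * t <= t by rewrite ler_piMl // ltW.
  have h1 : expR (- t / 4) <= u ^+ 2 by rewrite u2 ler_expR; lra.
  have h2 : expR (- (delta * (t / 2 - ln 2))) <= u ^+ 2 * 4.
    have e3 := expR1_le4.
    apply: le_trans (_ : expR (- (delta / 4 * t) + 1) <= _).
      have dl : delta * ln 2 <= 1 by apply: mulr_ile1 => //; rewrite ?ln_ge0 //; lra.
      have dt0 : 0 <= delta * t by rewrite mulr_ge0 // ltW.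
      by rewrite ler_expR; lra.
    by rewrite expRD -u2; apply: ler_wpM2l => //; rewrite ltW // exprn_gt0.
  move=> H.
  rewrite -(ler_pXn2r (_ : 0 < 2)%N) ?nnegrE //; last by rewrite mulr_ge0 ?ltW //; lra.
  apply: le_trans H _; rewrite exprMn.
  have : K * expR (- (delta * (t / 2 - ln 2))) <= K * (u ^+ 2 * 4).
    by apply: ler_wpM2l => //; lra.
  move: (u ^+ 2) h1 (exprn_gt0 2 u0) => v h1 v0 h3.
  apply: le_trans (_ : (8 + 4 * K) * v <= _); first by lra.
  apply: ler_wpM2r; first exact: ltW.
  by have := sqr_ge0 K; lra.
(* Here [i0] carries the only nonzero coefficient, |F| is constant, and (1 - y)^n <= 1 / (1 + n y)
   suffices. *)
rewrite (@defect_mean_single r c i0 n rA c1); last first.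
  move=> i ii0; apply: cD; apply: contra D1 => iD; apply/existsP; exists i.
  by rewrite iD.
have h1 : nm (c i0) <= 1.
  by apply: le_trans c1; rewrite /l1norm (bigD1 i0) //= lerDl sumr_ge0 // => *; exact: normc_ge0.
have := @single_defect_le (nm (c i0) ^+ 2) n; rewrite -/X.
have -> : 0 <= nm (c i0) ^+ 2 <= 1 by rewrite sqr_ge0 expr_le1 // normc_ge0.
move=> /(_ isT) H.
apply: le_trans (_ : X^-1 <= _).
  by rewrite -[X^-1]mul1r ler_pdivlMr //; apply: le_trans H; apply: ler_wpM2l; [rewrite exprn_ge0 // subr_ge0 expr_le1 // normc_ge0|lra].
rewrite XE -expRN; apply: le_trans (_ : expR (- (delta / 8 * t)) <= _).
  by have : delta * t <= t; [rewrite ler_piMl // ltW|rewrite ler_expR; lra].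
by rewrite ler_peMl ?expR_ge0 //; lra.
Qed.

End Tail.

(** * Approximate Mahler measures *)

Section LogApprox.
Variables (R : realType).

Definition log_poly N : {poly R} := \sum_(n < N) (n.+1%:R^-1) *: 'X^(n.+1).

Lemma horner_log_poly N (y : R) : (log_poly N).[y] = \sum_(n < N) y ^+ n.+1 / n.+1%:R.
Proof.
rewrite /log_poly horner_sum; apply: eq_bigr => n _.
by rewrite hornerZ hornerXn mulrC.
Qed.

Lemma deriv_log_poly N (y : R) : (log_poly N)^`().[y] = \sum_(n < N) y ^+ n.
Proof.
rewrite /log_poly raddf_sum horner_sum; apply: eq_bigr => n _.
rewrite /= derivZ derivXn hornerZ hornerMn hornerXn /= -(mulr_natl (y ^+ n)) mulKf //.
Qed.

(** The remainder of the series of - ln(1 - y) has derivative y^N / (1 - y), which increases with y;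
    the mean value theorem bounds it. *)
Lemma log_poly_bounds N (y : R) : 0 <= y < 1 ->
  0 <= - ln (1 - y) - (log_poly N).[y] <= y ^+ N / (1 - y).
Proof.
move=> /andP[]; rewrite le_eqVlt => /predU1P[<-|y0] y1.
  rewrite subr0 ln1 oppr0 sub0r horner_log_poly big1 ?oppr0 ?lexx => [|n _].
    by rewrite divr1 exprn_ge0.
  by rewrite expr0n mul0r.
pose f (t : R) := - ln (1 - t) - (log_poly N).[t].
pose df (t : R) := t ^+ N / (1 - t).
have dF (t : R) : t < 1 -> is_derive t 1 f (df t).
  move=> t1; have t1' : 0 < 1 - t by lra.
  have d1 : is_derive t 1 (fun t : R => ln (1 - t)) ((1 - t)^-1 * (-1)).
    have dg : is_derive t 1 (fun t : R => 1 - t) (-1).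
      have := @is_deriveB R R^o R^o _ _ t 1 _ _ (is_derive_cst (1 : R^o) t 1) (is_derive_id (t : R^o) 1).
      by rewrite sub0r.
    exact: (@is_derive1_comp R (@ln R) (fun t => 1 - t) t _ _ (is_derive1_ln t1') dg).
  have -> : df t = - ((1 - t)^-1 * -1) - (log_poly N)^`().[t].
    rewrite deriv_log_poly /df; have t1n : 1 - t != 0 by rewrite gt_eqF.
    apply: (mulIf t1n); rewrite divfK // mulrBl mulrN1 opprK mulVf //.
    by have := subrX1 t N; lra.
  exact: is_deriveB.
have [||z /[!in_itv]/= /andP[z0 zy]] := @MVT R f df 0 y y0.
- by move=> x /[!in_itv]/= /andP[_ xy]; apply: dF; lra.
- apply: derivable_within_continuous => x /[!in_itv]/= /andP[_ xy].
  by apply: ex_derive; apply: dF; lra.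
have -> : f 0 = 0.
  rewrite /f subr0 ln1 oppr0 sub0r horner_log_poly big1 ?oppr0 // => n _.
  by rewrite expr0n mul0r.
rewrite !subr0 -/(f y) => ->; rewrite /df.
have zN : 0 <= z ^+ N by rewrite exprn_ge0 // ltW.
have z1 : 0 < 1 - z by lra.
have q0 : 0 <= z ^+ N / (1 - z) by rewrite divr_ge0 // ltW.
apply/andP; split; first by rewrite mulr_ge0 // ltW.
apply: le_trans (_ : z ^+ N / (1 - z) <= _); first by rewrite ler_piMr // ltW.
apply: ler_pM => //; first by rewrite invr_ge0 ltW.
  by apply: lerXn2r; rewrite ?nnegrE; lra.
by rewrite lef_pV2 ?posrE //; lra.
Qed.

Lemma ln_le_log_poly N (x : R) : 0 < x <= 1 -> ln x <= - (log_poly N).[1 - x].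
Proof.
move=> /andP[x0 x1]; have /(log_poly_bounds N) : 0 <= 1 - x < 1 by lra.
by rewrite subKr => /andP[h _]; lra.
Qed.

Lemma log_poly_cvg (x : R) : 0 < x <= 1 -> - (log_poly N).[1 - x] @[N --> \oo] --> ln x.
Proof.
move=> /andP[x0 x1]; have h : 0 <= 1 - x < 1 by lra.
apply/cvgrPdist_le => e e0.
have : `|1 - x| < 1 by rewrite ger0_norm; lra.
move=> /cvg_expr /cvgrPdist_le /(_ (e * x)) [|N _ H]; first by rewrite mulr_gt0.
exists N => // n Nn /=; have := H n Nn; rewrite /= sub0r normrN.
have /andP[b1 b2] := log_poly_bounds n h.
move: b1 b2; rewrite subKr => b1 b2.
have xn0 : 0 <= (1 - x) ^+ n by rewrite exprn_ge0 //; case/andP: h.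
rewrite ger0_norm // => b3.
have b4 : (1 - x) ^+ n / x <= e by rewrite ler_pdivrMr.
rewrite ler_norml; lra.
Qed.

(** Divergence of the harmonic series, read off from the values just below 1. It accounts for the
    zeros of F, where the logarithm is -oo. *)
Lemma log_poly1_dvg (A : R) : exists N, forall M, (N <= M)%N -> A <= (log_poly M).[1].
Proof.
have x01 : 0 < expR (- (`|A| + 1)) <= 1.
  by rewrite expR_gt0 expR_le1 oppr_le0 addr_ge0.
have := log_poly_cvg x01; rewrite expRK => /cvgrPdist_le /(_ 1 ltr01) [N _ H].
exists N => M NM; have := H M NM; rewrite /= ler_norml => /andP[h _].
have : (log_poly M).[1 - expR (- (`|A| + 1))] <= (log_poly M).[1].
  rewrite !horner_log_poly; apply: ler_sum => n _; apply: ler_wpM2r => //.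
  by apply: lerXn2r; rewrite ?nnegrE; have := expR_gt0 (- (`|A| + 1)); case/andP: x01; lra.
have := ler_norm A; lra.
Qed.

End LogApprox.

Section MahlerApprox.
Variables (R : realType) (k : nat).
Implicit Types (c : 'I_k -> R[i]) (r : pred 'rV[int]_k) (b : 'I_k -> int).
Local Notation nm := (@Normc.normc R).

(* Mean over the torus of the N-th Taylor polynomial of [log |F|] in powers of
   [1 - |F|^2]; it decreases to the Mahler measure as N grows. *)
Definition mahler_approx c r N : R :=
  - 2^-1 * \sum_(n < N) defect_mean c r n.+1 / n.+1%:R.

Lemma mahler_approx_nonincreasing c r : approximable r -> l1norm c <= 1 ->
  {homo mahler_approx c r : N M / (N <= M)%N >-> M <= N}.
Proof.
move=> rA c1.
apply: (@homo_leq _ (mahler_approx c r) (fun x y => y <= x)) => // [x y z xy yz|N].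
  exact: le_trans yz xy.
rewrite /mahler_approx big_ord_recr /= mulrDr gerDl.
by rewrite mulNr oppr_le0 mulr_ge0 ?invr_ge0 // divr_ge0 // defect_mean_ge0.
Qed.

Lemma mahler_approx_lipschitz c c' r N : approximable r ->
  l1norm c <= 1 -> l1norm c' <= 1 ->
  `|mahler_approx c r N - mahler_approx c' r N| <= N%:R * \sum_i nm (c i - c' i).
Proof.
move=> rA c1 c1'; rewrite /mahler_approx -mulrBr -sumrB normrM normrN.
rewrite [X in X * _]ger0_norm ?invr_ge0 // ler_pdivrMl //.
apply: le_trans (ler_norm_sum _ _ _) _; rewrite mulrCA -[N in leRHS]card_ord mulr_natl.
rewrite -sumr_const; apply: ler_sum => n _.
rewrite -mulrBl normrM [X in _ * X]ger0_norm ?invr_ge0 // ler_pdivrMr //.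
apply: le_trans (defect_mean_lipschitz rA _ c1 c1') _.
by rewrite mulrAC.
Qed.

Lemma mahler_approx_avg c b r p (w : R[i]) N : p.-primitive_root w -> models r b p N ->
  mahler_approx c r N = p%:R^-1 * \sum_(j < p)
    - (2^-1 * (log_poly R N).[1 - nm (\sum_i twist c b (w ^+ j) i) ^+ 2]).
Proof.
move=> wp M; pose P j := (log_poly R N).[1 - nm (\sum_i twist c b (w ^+ j) i) ^+ 2].
have E : \sum_(n < N) defect_mean c r n.+1 / n.+1%:R = p%:R^-1 * \sum_(j < p) P j.
  rewrite /P; under [in RHS]eq_bigr do rewrite horner_log_poly.
  rewrite exchange_big mulr_sumr /=; apply: eq_bigr => n _.
  by rewrite (defect_mean_avg _ wp M) // -mulr_suml mulrA.
by rewrite /mahler_approx E sumrN -mulr_sumr; ring.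
Qed.

(** A telescoping majorant for the series of n^(-1-delta), replacing the integral test. *)
Lemma expR_ln_sum_le (delta : R) m : 0 < delta ->
  expR (- (delta * ln m.+2%:R)) / m.+2%:R <=
  delta^-1 * (expR (- (delta * ln m.+1%:R)) - expR (- (delta * ln m.+2%:R))).
Proof.
move=> d0; rewrite ler_pdivlMl //.
set u := expR (- (delta * ln m.+2%:R)).
have u0 : 0 < u := expR_gt0 _.
have -> : expR (- (delta * ln m.+1%:R)) = u * expR (delta * (ln m.+2%:R - ln m.+1%:R)).
  by rewrite -expRD; congr expR; ring.
have h : m.+2%:R^-1 <= ln m.+2%:R - ln m.+1%:R :> R.
  have : ln (1 + - m.+2%:R^-1) <= - m.+2%:R^-1 :> R.
    by apply: le_ln1Dx; rewrite ltrN2 invf_lt1 ?ltr0n // ltr1n.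
  have -> : 1 + - m.+2%:R^-1 = m.+1%:R / m.+2%:R :> R.
    by apply: (mulIf (_ : m.+2%:R != 0)) => //; rewrite mulrDl divfK // mulNr mulVf // -[m.+2%:R]natr1; ring.
  by rewrite ln_div ?posrE ?ltr0n // => H; rewrite -lerN2 opprB.
have := expR_ge1Dx (delta * (ln m.+2%:R - ln m.+1%:R)).
have : delta * m.+2%:R^-1 <= delta * (ln m.+2%:R - ln m.+1%:R) by apply: ler_wpM2l => //; exact: ltW.
move=> hy hE; rewrite mulrCA -[X in _ <= _ - X]mulr1 -mulrBr.
by apply: ler_wpM2l; [exact: ltW|rewrite lerBrDl; apply: le_trans hE; rewrite lerD2l].
Qed.

(** [defect_mean_tail] makes the n-th term O(n^(-1-delta)). As [N] precedes [r] and [c], one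
    truncation order serves all lattices and all normalised coefficients having one of size at least
    h. *)
Lemma mahler_approx_tail (h eps : R) : 0 < h -> 0 < eps -> exists N, forall r c i0,
  approximable r -> distinct r -> l1norm c <= 1 -> h <= nm (c i0) ->
  forall M, (N <= M)%N -> mahler_approx c r N - eps <= mahler_approx c r M.
Proof.
move=> h0 e0; have [K [delta [K1 d0 d1 T]]] := defect_mean_tail R k k.
pose C := K * expR (- (delta * ln (h ^+ 2))).
have C0 : 0 < C by rewrite mulr_gt0 ?expR_gt0 //; lra.
pose phi (m : nat) := expR (- (delta * ln m.+1%:R)) : R.
have [N NP] : exists N, C * delta^-1 * phi N <= eps.
  pose e := eps * delta / C.
  have e0' : 0 < e by rewrite divr_gt0 // mulr_gt0.
  pose x := expR (- (ln e / delta)).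
  have x0 : 0 < x := expR_gt0 _.
  exists (Num.truncn x); have xN := truncnS_gt x.
  have : phi (Num.truncn x) <= e.
    rewrite -[leRHS]lnK ?posrE // ler_expR lerNl.
    have : ln x <= ln (Num.truncn x).+1%:R.
      by rewrite ler_ln ?posrE ?ltr0n // ltW.
    rewrite expRK => H; have := ler_wpM2l (ltW d0) H.
    by rewrite mulrN mulrCA divff ?gt_eqF // mulr1.
  have Cd : 0 <= C / delta by rewrite divr_ge0 ?ltW.
  move=> /(ler_wpM2l Cd) H; apply: le_trans H _; rewrite /e.
  have -> : C / delta * (eps * delta / C) = eps; last exact: lexx.
  by field; rewrite !gt_eqF.
exists N.+1 => r c i0 rA rD c1 hc M NM.
have c0 : 0 < nm (c i0) by exact: lt_le_trans hc.
have A m : defect_mean c r m.+2 <= C * phi m.+1.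
  apply: le_trans (T r c [set: 'I_k]%SET i0 m.+2 rA rD c1 _ _ _ _) _ => //.
  - by rewrite cardsT card_ord.
  - by move=> i; rewrite inE.
  - by rewrite -normc_gt0.
  rewrite /C /phi -mulrA -expRD; apply: ler_wpM2l; first by lra.
  rewrite ler_expR -opprD lerN2 -mulrDr; apply: ler_wpM2l; first exact: ltW.
  rewrite addrC -lnM ?posrE ?exprn_gt0 ?ltr0n // ler_ln ?posrE; last first.
  - by rewrite mulr_gt0 ?exprn_gt0 ?ltr0n.
  - by rewrite mulr_gt0 ?exprn_gt0 ?ltr0n.
  by apply: ler_wpM2l => //; apply: lerXn2r => //; rewrite nnegrE ltW.
have tele L : \sum_(N.+1 <= n < N.+1 + L) defect_mean c r n.+1 / n.+1%:R
    <= C * delta^-1 * (phi N - phi (N + L)%N).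
  elim: L => [|L IH]; first by rewrite !addn0 big_geq // subrr mulr0.
  rewrite addnS big_nat_recr ?leq_addr //=.
  have := expR_ln_sum_le (N + L) d0; rewrite -/(phi _) -/(phi _).
  have -> : (N.+1 + L = (N + L).+1)%N by [].
  move=> H; have i2 : 0 <= (N + L).+2%:R^-1 :> R by [].
  have HA := ler_wpM2r i2 (A (N + L)%N).
  have := ler_wpM2l (ltW C0) H; rewrite !addnS.
  move: IH; rewrite (_ : (N.+1 + L = (N + L).+1)%N) // => IH H3.
  apply: le_trans (lerD IH HA) _.
  rewrite -[X in _ + X]mulrA; apply: le_trans (lerD (lexx _) H3) _.
  by rewrite le_eqVlt; apply/orP; left; apply/eqP; ring.
have S := tele (M - N.+1)%N; rewrite subnKC // in S.
have E : \sum_(n < M) defect_mean c r n.+1 / n.+1%:R =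
  \sum_(n < N.+1) defect_mean c r n.+1 / n.+1%:R +
  \sum_(N.+1 <= n < M) defect_mean c r n.+1 / n.+1%:R.
  rewrite -(big_mkord xpredT (fun n => defect_mean c r n.+1 / n.+1%:R)).
  rewrite -(big_mkord xpredT (fun n => defect_mean c r n.+1 / n.+1%:R)).
  by rewrite (big_cat_nat _ NM).
have S2 : \sum_(N.+1 <= n < M) defect_mean c r n.+1 / n.+1%:R <= eps.
  apply: le_trans S _; apply: le_trans NP; apply: ler_wpM2l.
    by rewrite divr_ge0 // ltW.
  by rewrite lerBlDr lerDl ltW // expR_gt0.
rewrite /mahler_approx E; lra.
Qed.

Lemma mahler_approx_lower c r N : approximable r -> l1norm c <= 1 ->
  - N%:R <= mahler_approx c r N.
Proof.
move=> rA c1; rewrite /mahler_approx mulNr lerN2 ler_pdivrMl //.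
apply: le_trans (_ : \sum_(n < N) 1 <= _).
  apply: ler_sum => n _; rewrite ler_pdivrMr // mul1r.
  by apply: le_trans (defect_mean_le1 rA _ c1) _; rewrite ler1n.
rewrite sumr_const card_ord; have : 0 <= N%:R :> R by []; lra.
Qed.

End MahlerApprox.

(** * Jensen's inequality *)

Section Jensen.
Variable R : realType.
Local Notation nm := (@Normc.normc R).

(** The factorisation of X^p - 1, homogenised. *)
Lemma prod_sub_roots p (w a rho : R[i]) : p.-primitive_root w -> rho != 0 ->
  \prod_(j < p) (a - rho * w ^+ j) = a ^+ p - rho ^+ p.
Proof.
move=> wp r0.
have E : \prod_(j < p) (a / rho - w ^+ j) = (a / rho) ^+ p - 1.
  have := factor_Xn_sub_1 wp => /(congr1 (fun q => q.[a / rho])).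
  rewrite horner_prod big_mkord !hornerE => <-.
  by apply: eq_bigr => j _; rewrite !hornerE.
rewrite (eq_bigr (fun j : 'I_p => rho * (a / rho - w ^+ j))) => [|j _].
  by rewrite big_split /= prodr_const card_ord E mulrBr mulr1 expr_div_n mulrC divfK ?expf_neq0.
by rewrite mulrBr [rho * (a / rho)]mulrC divfK.
Qed.

(** For x >= 0, x^p - 1 is x - 1 times 1 + x + ... + x^(p-1) >= 1. *)
Lemma normc_sub_expn_ge p (a : R[i]) (rho : R) : (0 < p)%N -> 0 < rho ->
  rho ^+ p * `|nm a / rho - 1| <= nm (a ^+ p - (rho%:C)%C ^+ p).
Proof.
move=> p0 r0; have := dist_normc (a ^+ p) ((rho%:C)%C ^+ p).
rewrite !normcX normc_real (gtr0_norm r0) => H; apply: le_trans H.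
set x := nm a / rho; have x0 : 0 <= x by rewrite divr_ge0 ?normc_ge0 // ltW.
have -> : nm a = rho * x by rewrite mulrC divfK // gt_eqF.
have -> : (rho * x) ^+ p - rho ^+ p = rho ^+ p * (x ^+ p - 1) by rewrite exprMn; ring.
rewrite normrM gtr0_norm ?exprn_gt0 //.
apply: ler_wpM2l; first by rewrite exprn_ge0 // ltW.
rewrite subrX1 normrM ler_peMr // ger0_norm; last by apply: sumr_ge0 => i _; exact: exprn_ge0.
case: p p0 => // p _; rewrite big_ord_recl expr0 lerDl.
by apply: sumr_ge0 => i _; exact: exprn_ge0.
Qed.

(** A discrete Jensen formula. The last product does not depend on p, so it disappears after a p-th
    root when p grows. *)
Lemma prod_normc_horner_ge p (w : R[i]) (g : {poly R[i]}) (s : seq R[i]) (rho : R) :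
  p.-primitive_root w -> 0 < rho -> g = lead_coef g *: \prod_(z <- s) ('X - z%:P) ->
  nm (lead_coef g) ^+ p * (rho ^+ p) ^+ size s * \prod_(z <- s) `|nm z / rho - 1| <=
  \prod_(j < p) nm (g.[(rho%:C)%C * w ^+ j]).
Proof.
move=> wp r0 gE; have p0 := prim_order_gt0 wp.
have rC0 : (rho%:C)%C != 0 by rewrite -normc_gt0 normc_real normr_gt0 gt_eqF.
have -> : \prod_(j < p) nm (g.[(rho%:C)%C * w ^+ j]) =
    nm (lead_coef g) ^+ p * \prod_(z <- s) nm (z ^+ p - (rho%:C)%C ^+ p).
  have hE x : nm g.[x] = nm (lead_coef g) * \prod_(z <- s) nm ('X - z%:P).[x].
    by rewrite {1}gE hornerZ Normc.normcM horner_prod normc_prod.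
  rewrite (eq_bigr _ (fun j _ => hE _)).
  rewrite big_split /= prodr_const card_ord; congr (_ * _).
  rewrite exchange_big /=; apply: eq_bigr => z _.
  rewrite -(prod_sub_roots _ wp rC0) normc_prod; apply: eq_bigr => j _.
  by rewrite !hornerE normcC.
rewrite -mulrA; apply: ler_wpM2l; first by rewrite exprn_ge0 ?normc_ge0.
elim: s {gE} => [|z s IH]; first by rewrite !big_nil expr0 mulr1.
rewrite !big_cons /= exprS mulrACA; apply: ler_pM => //.
- by rewrite mulr_ge0 // exprn_ge0 // ltW.
- by rewrite mulr_ge0 ?exprn_ge0 ?prodr_ge0 // ltW.
- exact: normc_sub_expn_ge.
Qed.

Lemma ln_prod_ord p (F : 'I_p -> R) : (forall j, 0 < F j) ->
  ln (\prod_j F j) = \sum_j ln (F j).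
Proof.
move=> F0; suff [] : ln (\prod_j F j) = \sum_j ln (F j) /\ 0 < \prod_j F j by [].
apply: (big_ind2 (fun x y => ln x = y /\ 0 < x)) => //; first by rewrite ln1.
by move=> x1 y1 x2 y2 [<- x10] [<- x20]; rewrite lnM ?posrE // mulr_gt0.
Qed.

Lemma exists_notin_near_one (s : seq R) (tau : R) : 0 < tau ->
  exists rho, [/\ 1 - tau <= rho, rho < 1 & rho \notin s].
Proof.
move=> t0; pose f m : R := 1 - tau / m.+1%:R.
have [/allP H|/allPn[rho /mapP[m _ ->] ms]] :=
    boolP (all (fun x => x \in s) (mkseq f (size s).+1)).
  have : uniq (mkseq f (size s).+1).
    rewrite mkseq_uniq // => m n /addrI /oppr_inj /(mulfI (lt0r_neq0 t0)) /invr_inj /eqP.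
    by rewrite eqr_nat => /eqP[].
  by move=> /uniq_leq_size /(_ H); rewrite size_mkseq ltnn.
exists (f m); split => //; rewrite /f.
  rewrite lerD2l lerN2 ler_pdivrMr // ler_peMr ?ler1n //; exact: ltW.
by rewrite gtrBl divr_gt0.
Qed.

Variable k : nat.
Implicit Types (c : 'I_k -> R[i]) (r : pred 'rV[int]_k) (b : 'I_k -> int).

(** On a circle of radius rho that avoids the moduli of the roots, the mean of log |g| over p points
    is bounded below by [prod_normc_horner_ge]; the truncated logarithm lies above the logarithm.
    The shift by [B] makes the Laurent polynomial a polynomial without changing its modulus on the
    unit circle. *)
Lemma mahler_approx_scaled_ge c r b (e : 'I_k -> nat) (B : int) g s (rho : R) N p (w : R[i]) :
  approximable r -> p.-primitive_root w -> models r b p N ->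
  (forall i, (e i : int) = b i - B) -> g = \sum_i c i *: 'X^(e i) ->
  g = lead_coef g *: \prod_(z <- s) ('X - z%:P) -> lead_coef g != 0 ->
  0 < rho -> rho <= 1 -> rho \notin map nm s -> l1norm c <= 1 ->
  ln (nm (lead_coef g)) + (size s)%:R * ln rho +
    p%:R^-1 * ln (\prod_(z <- s) `|nm z / rho - 1|) <=
  mahler_approx (fun i => c i * (rho%:C)%C ^+ e i) r N.
Proof.
move=> rA wp M eE gS gE g0 r0 r1 rs c1; have p0 := prim_order_gt0 wp.
have p0' : 0 < p%:R :> R by rewrite ltr0n.
set kap := \prod_(z <- s) _.
have k0 : 0 < kap.
  rewrite /kap big_seq; apply: prodr_gt0 => z zs; rewrite normr_gt0 subr_eq0.
  apply: contra rs => /eqP h; apply/mapP; exists z => //.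
  by rewrite -[LHS]mul1r -h divfK // gt_eqF.
rewrite (mahler_approx_avg _ wp M) -(ler_pM2l p0') mulVKf ?gt_eqF //.
pose G (j : 'I_p) := nm (g.[(rho%:C)%C * w ^+ j]).
have w1 (j : nat) : nm (w ^+ j) = 1 by rewrite normcX (normc_prim_root wp) expr1n.
have GE (j : 'I_p) :
    nm (\sum_i twist (fun i => c i * (rho%:C)%C ^+ e i) b (w ^+ j) i) = G j.
  have -> : \sum_i twist (fun i => c i * (rho%:C)%C ^+ e i) b (w ^+ j) i =
      (w ^+ j) ^ B * g.[(rho%:C)%C * w ^+ j].
    rewrite gS horner_sum mulr_sumr; apply: eq_bigr => i _.
    rewrite /twist hornerZ hornerXn exprMn.
    have -> : (w ^+ j) ^ b i = (w ^+ j) ^ B * (w ^+ j) ^+ e i.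
      have -> : (w ^+ j) ^+ e i = (w ^+ j) ^ (e i : int) by [].
      by rewrite eE -expfzDr -?normc_gt0 ?w1 // addrC subrK.
    by ring.
  by rewrite Normc.normcM normcXz w1 exp1rz mul1r.
have P := prod_normc_horner_ge wp r0 gE; rewrite -/kap in P.
have lead0 : 0 < nm (lead_coef g) by rewrite normc_gt0.
have L0 : 0 < nm (lead_coef g) ^+ p * (rho ^+ p) ^+ size s * kap.
  by rewrite !mulr_gt0 ?exprn_gt0.
(* A zero value would contradict the positive lower bound on the product. *)
have G0 j : 0 < G j.
  rewrite lt_def normc_ge0 andbT; apply/eqP => Gj.
  by move: P; rewrite leNgt (bigD1 j) //= -/(G j) Gj mul0r L0.
have G1 j : G j <= 1.
  rewrite -GE; apply: le_trans (normc_sum _ _ _) _; rewrite -/(l1norm _) l1norm_twist //.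
  apply: le_trans c1; apply: ler_sum => i _.
  rewrite Normc.normcM normcX normc_real gtr0_norm // ler_piMr ?normc_ge0 //.
  by rewrite exprn_ile1 // ltW.
apply: le_trans (_ : \sum_j ln (G j) <= _); last first.
  apply: ler_sum => j _; rewrite GE.
  have G2 : 0 < G j ^+ 2 <= 1 by rewrite exprn_gt0 // exprn_ile1 // normc_ge0.
  by have := ln_le_log_poly N G2; rewrite lnXn // mulr2n; lra.
rewrite -ln_prod_ord // -/G; apply: le_trans (_ : ln (nm (lead_coef g) ^+ p * (rho ^+ p) ^+ size s * kap) <= _).
  rewrite !lnM ?posrE ?mulr_gt0 ?exprn_gt0 // !lnXn ?exprn_gt0 //.
  set u := ln (nm _); set v := ln rho; set q := ln kap.
  have <- : p%:R * (u + (size s)%:R * v + p%:R^-1 * q) = u *+ p + v *+ p *+ size s + q.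
    rewrite -(mulr_natl u) -(mulr_natl _ (size s)) -(mulr_natl v).
    by field; rewrite gt_eqF.
  exact: lexx.
by rewrite ler_ln ?posrE // prodr_gt0.
Qed.

(** Jensen's inequality: [i] is the index of the leading monomial of a one-variable model. The bound
    on a circle of radius rho is transferred to the unit circle by letting rho tend to 1 and p to
    infinity. *)
Lemma mahler_approx_ge c r N : approximable r -> distinct r -> l1norm c <= 1 ->
  (exists i, c i != 0) -> exists2 i, c i != 0 & ln (nm (c i)) <= mahler_approx c r N.
Proof.
move=> rA rD c1 [i0 ci0]; have [b [p0 bM]] := rA N.+1.
have [p1 p01 Pp1] := prime_above p0.
have bD i j : i != j -> b i != b j.
  move=> ij; have := models_distinct rD (bM p1 (ltnW p01) Pp1) isT ij.
  by apply: contra => /eqP ->; rewrite subrr dvdn0.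
pose B : int := - \sum_i `|b i|.
have Bb i : 0 <= b i - B.
  rewrite /B opprK (bigD1 i) //= addrA addr_ge0 ?sumr_ge0 //.
  by rewrite -lerBlDl sub0r -normrN ler_norm.
pose e i := `|b i - B|%N.
have eE i : (e i : int) = b i - B by rewrite /e gez0_abs.
have e_inj : injective e.
  move=> i j eij; apply/eqP; apply: contraT => /bD; rewrite -(inj_eq (addIr (- B))).
  by rewrite -!eE eij eqxx.
pose g := \sum_i c i *: 'X^(e i).
have gC m : g`_m = \sum_i c i * (m == e i)%:R.
  by rewrite coef_sum; apply: eq_bigr => i _; rewrite coefZ coefXn.
have [t ct et] : exists2 t, c t != 0 & forall i, c i != 0 -> (e i <= e t)%N.
  by case: (@arg_maxnP _ i0 (fun i => c i != 0) e ci0) => t ct et; exists t.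
have gt : g`_(e t) = c t.
  rewrite gC (bigD1 t) //= eqxx mulr1 big1 ?addr0 // => i it.
  by rewrite (inj_eq e_inj) eq_sym (negPf it) mulr0.
have sg : size g = (e t).+1.
  apply/eqP; rewrite eqn_leq; apply/andP; split; last first.
    by rewrite ltnNge; apply/negP => /leq_sizeP /(_ _ (leqnn _)) /eqP; rewrite gt (negPf ct).
  apply/leq_sizeP => m tm; rewrite gC big1 // => i _.
  have [->|ci] := eqVneq (c i) 0; first by rewrite mul0r.
  rewrite (_ : (m == e i) = false) ?mulr0 //; apply/eqP => mE.
  by have := et i ci; rewrite -mE leqNgt tm.
have lg : lead_coef g = c t by rewrite lead_coefE sg.
have [s gE] := closed_field_poly_normal g.
exists t => //; apply/ler_addgt0Pr => eps eps0; rewrite -lerBlDr.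
(* W (1 - rho) covers the losses due to rho: the first summand comes from the Lipschitz bound, the
   second from ln rho >= - 2 (1 - rho), valid as rho >= 1/2; the 1 keeps W positive. *)
pose W : R := N%:R * (\sum_i (e i)%:R) + 2 * (size s)%:R + 1.
have S0 : 0 <= \sum_i (e i)%:R :> R by apply: sumr_ge0.
have W0 : 0 < W by rewrite /W ltr_wpDl // addr_ge0 // mulr_ge0.
pose tau := Num.min (1 / 2) (eps / 2 / W).
have tau0 : 0 < tau by rewrite lt_min; apply/andP; split; [lra|rewrite !divr_gt0].
have [rho [rho_ge rho1 rhos]] := exists_notin_near_one (map nm s) tau0.
have tau12 : tau <= 1 / 2 by rewrite ge_min lexx.
have tauW : tau <= eps / 2 / W by rewrite ge_min lexx orbT.
have rho0 : 0 < rho by lra.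
set kap := \prod_(z <- s) `|nm z / rho - 1|.
(* For such p the leftover term |ln kap| / p is at most eps / 2. *)
have [p pk Pp] := prime_above (maxn p0 (Num.truncn (2 * `|ln kap| / eps)).+1).
have [w wp] := prim_root_exists R Pp.
have M : models r b p N.
  move=> n nN; apply: bM => //; last exact: leqW.
  exact: leq_trans (leq_maxl _ _) (ltnW pk).
have H := mahler_approx_scaled_ge rA wp M eE erefl gE _ rho0 (ltW rho1) rhos c1.
rewrite -/kap lg in H; have {}H := H ct.
set c' := fun i => _ in H.
have c1' : l1norm c' <= 1.
  apply: le_trans c1; apply: ler_sum => i _.
  rewrite Normc.normcM normcX normc_real gtr0_norm // ler_piMr ?normc_ge0 //.
  by rewrite exprn_ile1 // ltW.
have := mahler_approx_lipschitz N rA c1 c1'; rewrite ler_norml => /andP[L _].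
have D : \sum_i nm (c i - c' i) <= (\sum_i (e i)%:R) * (1 - rho).
  rewrite mulr_suml; apply: ler_sum => i _.
  have -> : c i - c' i = c i * ((1 - rho ^+ e i)%:C)%C.
    by rewrite rmorphB rmorph1 rmorphXn /= mulrBr mulr1.
  have re1 : 0 <= 1 - rho ^+ e i by rewrite subr_ge0 exprn_ile1 // ltW.
  rewrite Normc.normcM normc_real ger0_norm //.
  apply: le_trans (_ : 1 * (1 - rho ^+ e i) <= _).
    apply: ler_wpM2r => //.
    apply: le_trans c1; rewrite /l1norm (bigD1 i) //= lerDl.
    by apply: sumr_ge0 => *; exact: normc_ge0.
  rewrite mul1r; have := @ler_dist_expn R 1 rho (e i); rewrite expr1n.
  rewrite (ger0_norm re1) ger0_norm; last by lra.
  by apply; rewrite ?lexx ?ler01 ?(ltW rho1) ?(ltW rho0).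
have lnr : - (2 * (1 - rho)) <= ln rho.
  rewrite -[rho in leRHS]invrK lnV ?posrE ?invr_gt0 // lerN2.
  have := @le_ln1Dx R (rho^-1 - 1); rewrite (addrC 1) subrK => h.
  apply: le_trans (h _) _; first by rewrite ltrBrDr addNr invr_gt0.
  rewrite -(ler_pM2r rho0) mulrBl mulVf ?gt_eqF //; nra.
have pk' : - (eps / 2) <= p%:R^-1 * ln kap.
  have p0' : 0 < p%:R :> R by rewrite ltr0n prime_gt0.
  rewrite ler_pdivlMl //.
  have : 2 * `|ln kap| / eps <= p%:R.
    apply: ltW; apply: lt_le_trans (truncnS_gt _) _; rewrite ler_nat.
    exact: leq_trans (leq_maxr _ _) (ltnW pk).
  rewrite ler_pdivrMr // => h; have := lerNnormlW (lexx `|ln kap|); lra.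
have NS : N%:R * \sum_i nm (c i - c' i) <= N%:R * ((\sum_i (e i)%:R) * (1 - rho)).
  by apply: ler_wpM2l.
have sz : (size s)%:R * - (2 * (1 - rho)) <= (size s)%:R * ln rho by apply: ler_wpM2l.
have Wb : W * (1 - rho) <= eps / 2.
  by rewrite -ler_pdivlMl // mulrC; lra.
have rho1' : 0 <= 1 - rho by lra.
move: Wb; rewrite /W !mulrDl mul1r; lra.
Qed.

End Jensen.

(** * Relation lattices *)

Section RelationLattices.
Variable k : nat.
Implicit Types (r : pred 'rV[int]_k) (b : 'I_k -> int).

Definition relations l (A : 'M[int]_(k, l)) : pred 'rV[int]_k := fun v => v *m A == 0.

(** By [relations_saturated] and [saturated_relations] these are exactly the relation lattices of k
    vectors in some Z^l. This description passes to limits along an ultrafilter. *)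
Definition saturated r := [/\ r 0, forall u v, r u -> r v -> r (u - v) &
  forall (n : int) v, n != 0 -> r (n *: v) -> r v].

Lemma relations_saturated l (A : 'M[int]_(k, l)) : saturated (relations A).
Proof.
rewrite /relations; split; first by rewrite mul0mx.
  by move=> u v /eqP uA /eqP vA; rewrite mulmxBl uA vA subrr.
move=> n v n0; rewrite -scalemxAl => /eqP h; apply/eqP/matrixP => i j.
have /matrixP /(_ i j) := h; rewrite !mxE => /eqP.
by rewrite mulf_eq0 (negPf n0) => /eqP.
Qed.

Lemma exists_nonroot (Q : {poly int}) : Q != 0 -> exists T : nat, Q.[T%:Z] != 0.
Proof.
move=> Q0; pose s := [seq (i%:Z : int) | i <- iota 0 (size Q)].
have [H|/allPn[x /mapP[i _ ->] xr]] := boolP (all (root Q) s); last by exists i.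
have : uniq s by rewrite map_inj_uniq ?iota_uniq // => i j [].
by move=> /(max_poly_roots Q0 H); rewrite size_map size_iota ltnn.
Qed.

(** Kronecker substitution: T_j = T^j, where the integer T is not a root of the product of the
    polynomials attached to the nonzero vectors of W. *)
Lemma exists_separating l (W : seq 'rV[int]_l) :
  exists T : 'I_l -> int, forall w, w \in W -> w != 0 -> \sum_j w 0 j * T j != 0.
Proof.
pose P (w : 'rV[int]_l) : {poly int} := \sum_j w 0 j *: 'X^j.
have P0 w : w != 0 -> P w != 0.
  apply: contra => /eqP Pw; apply/eqP/rowP => j; rewrite mxE.
  have := congr1 (fun q : {poly int} => q`_j) Pw.
  rewrite coef0 coef_sum (bigD1 j) //= coefZ coefXn eqxx mulr1 big1 ?addr0 // => i ij.
  by rewrite coefZ coefXn eq_sym (inj_eq val_inj) (negPf ij) mulr0.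
pose Q := \prod_(w <- W | w != 0) P w.
have Q0 : Q != 0.
  by apply: (big_ind (fun q => q != 0)) => [|x y x0 y0|w /P0//]; rewrite ?oner_eq0 ?mulf_neq0.
have [T QT] := exists_nonroot Q0; exists (fun j => T%:Z ^+ j) => w wW w0.
have -> : \sum_j w 0 j * T%:Z ^+ j = (P w).[T%:Z].
  by rewrite horner_sum; apply: eq_bigr => j _; rewrite hornerZ hornerXn.
apply: contra QT => /eqP PT; rewrite /Q horner_prod.
by rewrite (big_rem w) //= w0 PT mul0r.
Qed.

(** Only finitely many exponent vectors occur up to order N. A separating linear form reduces A to
    one column, and a prime above all resulting integers divides none of the nonzero ones. *)
Lemma relations_approximable l (A : 'M[int]_(k, l)) : approximable (relations A).
Proof.
move=> N; pose idx := option ('I_k * 'I_k).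
pose V := flatten [seq [seq exp_vec s | s <- enum {: {ffun 'I_n -> idx}}] | n <- iota 0 N.+1].
have VP n (s : {ffun 'I_n -> idx}) : (n <= N)%N -> exp_vec s \in V.
  move=> nN; apply/flatten_mapP; exists n; first by rewrite mem_iota.
  by apply/mapP; exists s => //; rewrite mem_enum.
have [T HT] := exists_separating [seq v *m A | v <- V].
pose b i := \sum_j A i j * T j.
have bE v : dotz b v = \sum_j (v *m A) 0 j * T j.
  rewrite /dotz /b; under eq_bigr do rewrite mulr_sumr.
  rewrite exchange_big /=; apply: eq_bigr => j _.
  by rewrite mxE mulr_suml; apply: eq_bigr => i _; rewrite mulrA.
exists b, (\sum_(v <- V) `|dotz b v|).+1%N => p pV Pp n nN s.
have sV := VP n s nN; rewrite /relations.
have [vA|vA] := eqVneq.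
  rewrite bE vA big1 ?dvdn0 // => j _.
  by rewrite mxE mul0r.
have d0 : dotz b (exp_vec s) != 0 by rewrite bE HT //; apply: map_f.
have lt : (`|dotz b (exp_vec s)| < p)%N.
  apply: leq_trans pV; rewrite ltnS (big_rem _ sV) /=; exact: leq_addr.
by rewrite gtnNdvd // absz_gt0.
Qed.

Lemma saturated_opp r v : saturated r -> r v -> r (- v).
Proof. by move=> [r0 rB _] rv; rewrite -sub0r; apply: rB. Qed.

Lemma saturated_add r u v : saturated r -> r u -> r v -> r (u + v).
Proof.
by move=> rS ru rv; have [_ rB _] := rS; rewrite -[v]opprK; apply: rB => //; exact: saturated_opp.
Qed.

Lemma saturated_scale r (n : int) v : saturated r -> r v -> r (n *: v).
Proof.
move=> rS rv; have H (m : nat) : r (m%:Z *: v).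
  elim: m => [|m IH]; first by rewrite scale0r; case: rS.
  by rewrite intS scalerDl scale1r; apply: saturated_add.
case: n => m; first exact: H.
by rewrite NegzE scaleNr; apply: saturated_opp.
Qed.

Lemma saturated_mulmx r m (u : 'rV[int]_m) (W : 'M[int]_(m, k)) : saturated r ->
  (forall i, r (row i W)) -> r (u *m W).
Proof.
move=> rS rW; rewrite mulmx_sum_row; apply: (big_ind r) => [|x y|i _].
- by case: rS.
- exact: saturated_add.
- exact: saturated_scale.
Qed.

Lemma clear_denominators m n (M : 'M[rat]_(m, n)) :
  exists D : int, exists2 B : 'M[int]_(m, n), D != 0 & map_mx intr B = D%:~R *: M.
Proof.
pose D := \prod_(x : 'I_m * 'I_n) denq (M x.1 x.2).
pose D' x := \prod_(y : 'I_m * 'I_n | y != x) denq (M y.1 y.2).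
exists D, (\matrix_(i, j) (numq (M i j) * D' (i, j))).
  by apply/prodf_neq0 => x _; exact: denq_neq0.
apply/matrixP => i j; rewrite !mxE /D (bigD1 (i, j)) //= -/(D' (i, j)).
by rewrite !intrM -{3}(divq_num_den (M i j)) mulrAC mulrCA mulfV ?intr_eq0 ?denq_neq0 // mulr1 mulrC.
Qed.

(* The rows of W form a maximal Q-independent family of elements of [r]. *)
Lemma saturated_basis r : saturated r -> exists m, exists W : 'M[int]_(m, k),
  (forall i, r (row i W)) /\
  forall v, r v = (map_mx (intr : int -> rat) v <= map_mx (intr : int -> rat) W)%MS.
Proof.
move=> rS; pose f := (intr : int -> rat).
pose P m := `[< exists W : 'M[int]_(m, k), (forall i, r (row i W)) /\ \rank (map_mx f W) = m >].
have P0 : exists m, P m.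
  exists 0%N; apply/asboolP; exists 0; split; first by case.
  by apply/eqP; rewrite -leqn0 rank_leq_row.
have Pk m : P m -> (m <= k)%N by move=> /asboolP[W [_ <-]]; exact: rank_leq_col.
have [m /asboolP[W [rW kW]] mmax] := ex_maxnP P0 Pk.
exists m, W; split => // v; apply/idP/idP => [rv|].
  apply: contraT => nv; have /asboolP/mmax : exists W' : 'M[int]_(m + 1, k),
      (forall i, r (row i W')) /\ \rank (map_mx f W') = (m + 1)%N.
    exists (col_mx W v); split => [i|].
      case: (splitP i) => j ij.
        have -> : i = lshift 1 j by exact: val_inj.
        by rewrite rowKu.
      have -> : i = rshift m j by exact: val_inj.
      by rewrite rowKd (ord1 j) row_id.
    rewrite map_col_mx; apply/eqP; rewrite eqn_leq rank_leq_row /=.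
    have sub : (map_mx f W <= col_mx (map_mx f W) (map_mx f v))%MS.
      by rewrite -addsmxE addsmxSl.
    have : (\rank (map_mx f W) < \rank (col_mx (map_mx f W) (map_mx f v)))%N.
      rewrite (ltn_leqif (mxrank_leqif_sup sub)) -addsmxE; apply: contra nv => h.
      exact: submx_trans (addsmxSr _ _) h.
    by rewrite kW => h; apply: leq_trans h; rewrite addn1.
  by rewrite addn1 ltnn.
move=> /submxP[D vE]; have [N [u N0 uE]] := clear_denominators D.
have [_ _ /(_ N v N0)] := rS; apply.
suff -> : N *: v = u *m W by exact: saturated_mulmx.
apply/matrixP => i j; have /matrixP /(_ i j) : map_mx f (N *: v) = map_mx f (u *m W).
  by rewrite map_mxM uE -scalemxAl -vE map_mxZ.
by rewrite !mxE => /eqP; rewrite /f eqr_int => /eqP.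
Qed.

(** By saturation [r] consists of the integer points of its rational span, which is the kernel of a
    cokernel matrix; B is that matrix with denominators cleared. *)
Lemma saturated_relations r : saturated r -> exists B : 'M[int]_k, r = relations B.
Proof.
move=> rS; have [m [W [_ rW]]] := saturated_basis rS.
have [D [B D0 BE]] := clear_denominators (cokermx (map_mx (intr : int -> rat) W)).
exists B; apply/funext => v; rewrite rW submxE /relations.
have E : map_mx intr (v *m B) = D%:~R *: (map_mx (intr : int -> rat) v *m
    cokermx (map_mx intr W)) by rewrite map_mxM BE -scalemxAr.
apply/eqP/eqP => [h|h]; last first.
  apply/eqP; move/eqP: E; rewrite h map_mx0 eq_sym scaler_eq0 intr_eq0 (negPf D0) //.
apply/rowP => j; have /rowP /(_ j) := E.
by rewrite h scaler0 !mxE => /eqP; rewrite intr_eq0 => /eqP.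
Qed.

(** Inclusion in another saturated lattice thus becomes a finite condition, which holds on a set of
    an ultrafilter as soon as each of its parts does. *)
Lemma saturated_generators r : saturated r -> exists V : seq 'rV[int]_k,
  (forall w, w \in V -> r w) /\
  forall r', saturated r' -> (forall w, w \in V -> r' w) -> forall v, r v -> r' v.
Proof.
move=> rS; have [m [W [Wr rW]]] := saturated_basis rS.
exists [seq row i W | i <- enum 'I_m]; split=> [_ /mapP[i _ ->]//|r' rS' H v].
rewrite rW => /submxP[D vE]; have [N [u N0 uE]] := clear_denominators D.
have [_ _ /(_ N v N0)] := rS'; apply.
suff -> : N *: v = u *m W.
  by apply: saturated_mulmx => // i; apply: H; apply: map_f; rewrite mem_enum.
apply/matrixP => i j.
have /matrixP /(_ i j) : map_mx (intr : int -> rat) (N *: v) = map_mx intr (u *m W).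
  by rewrite map_mxM uE -scalemxAl -vE map_mxZ.
by rewrite !mxE => /eqP; rewrite eqr_int => /eqP.
Qed.

End RelationLattices.

(** * Isolation by recurrence *)

Section Recurrence.
Variables (R : realType) (k : nat).
Implicit Types (c : 'I_k -> R[i]) (r : pred 'rV[int]_k) (b : 'I_k -> int).
Local Notation nm := (@Normc.normc R).

Lemma pigeonhole_card (T U : finType) (f : T -> U) (t0 : T) :
  exists t, (#|T| <= #|U| * #|[pred x | f x == f t]|)%N.
Proof.
have [t _ tmax] := @arg_maxnP _ t0 xpredT (fun t => #|[pred x | f x == f t]|) isT.
exists t; rewrite -sum1_card (partition_big f xpredT) //= -sum_nat_const.
rewrite (eq_bigl xpredT) //; apply: leq_sum => u _.
have [/existsP[x /eqP <-]|] := boolP [exists x, f x == u].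
  by rewrite sum1_card; exact: tmax.
rewrite negb_exists => /forallP H; rewrite big1 // => x /eqP fx.
by have := H x; rewrite fx eqxx.
Qed.

Lemma truncn_eq_dist (x y : R) : 0 <= x -> 0 <= y -> Num.truncn x = Num.truncn y ->
  `|x - y| <= 1.
Proof.
move=> /truncn_itv /andP[x1 x2] /truncn_itv /andP[y1 y2] E.
by move: x1 x2; rewrite E => x1 x2; rewrite ler_norml; move: y2 x2; rewrite -natr1; lra.
Qed.

Lemma normc_le_ReIm (z : R[i]) : nm z <= `|complex.Re z| + `|complex.Im z|.
Proof.
case: z => a b /=; rewrite -[leRHS]ger0_norm ?addr_ge0 // -sqrtr_sqr ler_wsqrtr //.
rewrite sqrrD !real_normK ?num_real // -addrA lerD2l lerDr.
by rewrite mulrn_wge0 // mulr_ge0.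
Qed.

Lemma ReIm_le1 (z : R[i]) : nm z = 1 ->
  -1 <= complex.Re z <= 1 /\ -1 <= complex.Im z <= 1.
Proof.
case: z => a b /= /(congr1 (fun x => x ^+ 2)); rewrite expr1n sqr_sqrtr ?addr_ge0 ?sqr_ge0 // => h.
have := sqr_ge0 a; have := sqr_ge0 b.
by move=> *; split; apply/andP; split; nra.
Qed.

Definition near1 b (w : R[i]) (rho : R) (j : nat) : bool :=
  [forall i, nm ((w ^+ j) ^ b i - 1) <= rho].

(** Dirichlet's pigeonhole: cut the k-dimensional torus into Q cells. Some cell is visited at least
    p / Q times, and differences of visiting times are return times near 1. Q depends on k and rho
    alone. *)
Lemma recurrence (rho : R) : 0 < rho -> exists2 Q : nat, (0 < Q)%N &
  forall p (w : R[i]) b, p.-primitive_root w -> (p <= Q * #|[pred j : 'I_p | near1 b w rho j]|)%N.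
Proof.
(* Cells have side 1/K in real and imaginary parts, hence diameter at most 2/K <= rho per
   coordinate. *)
move=> r0; pose K := (Num.truncn (2 / rho)).+1.
have K0 : 0 < K%:R :> R by rewrite ltr0n.
have KP : 2 / K%:R <= rho.
  rewrite ler_pdivrMr // -ler_pdivrMl // mulrC ltW //; exact: truncnS_gt.
pose cellT := {ffun 'I_k -> 'I_(2 * K).+1 * 'I_(2 * K).+1}.
exists #|{: cellT}| => [|p w b wp].
  by apply/card_gt0P; exists [ffun=> (ord0, ord0)].
have p0 := prim_order_gt0 wp.
have w1 (j : nat) i : nm ((w ^+ j) ^ b i) = 1.
  by rewrite normcXz normcX (normc_prim_root wp) expr1n exp1rz.
pose co (x : R) : 'I_(2 * K).+1 := inord (Num.truncn ((x + 1) * K%:R)).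
have coP (x y : R) : -1 <= x <= 1 -> -1 <= y <= 1 -> co x = co y -> `|x - y| <= K%:R^-1.
  move=> /andP[x0 x1] /andP[y0 y1] /(congr1 val) /=.
  have B (u : R) : -1 <= u -> u <= 1 -> (Num.truncn ((u + 1) * K%:R) < (2 * K).+1)%N.
    move=> u0 u1; rewrite ltnS -(ler_nat R) natrM.
    apply: le_trans (_ : (u + 1) * K%:R <= _); last by apply: ler_wpM2r; lra.
    by rewrite truncn_le mulr_ge0 //; lra.
  rewrite !inordK ?B // => /truncn_eq_dist H.
  have : `|(x + 1) * K%:R - (y + 1) * K%:R| <= 1.
    by apply: H; rewrite mulr_ge0 //; lra.
  rewrite -mulrBl normrM [X in _ * X]gtr0_norm // -ler_pdivlMr // mul1r.
  by have -> : x + 1 - (y + 1) = x - y by ring.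
pose cell (j : 'I_p) : cellT :=
  [ffun i => (co (complex.Re ((w ^+ j) ^ b i)), co (complex.Im ((w ^+ j) ^ b i)))].
have [j0 Hj0] := pigeonhole_card cell (Ordinal p0).
rewrite card_ord in Hj0; apply: leq_trans Hj0 _; rewrite leq_mul2l; apply/orP; right.
(* This is j - j0 modulo p. *)
pose h (j : 'I_p) : 'I_p := Ordinal (ltn_pmod (j + (p - j0)) p0).
have hi : injective h.
  move=> s t /(congr1 val) /= /eqP; rewrite eqn_modDr !modn_small // => /eqP.
  exact: val_inj.
rewrite -(fintype.card_image hi); apply: subset_leq_card; apply/fintype.subsetP => _ /fintype.imageP[j jc ->].
have {}jc : cell j = cell j0 by apply/eqP.
rewrite inE; apply/forallP => i; rewrite /= (prim_expr_mod wp).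
have wj0 : w ^+ j0 != 0 by rewrite -normc_gt0 normcX (normc_prim_root wp) expr1n.
have E : (w ^+ (j + (p - j0))) ^ b i * (w ^+ j0) ^ b i = (w ^+ j) ^ b i.
  rewrite -exprMz_comm; last exact: mulrC.
  - by rewrite -exprD -addnA subnK ?(ltnW (ltn_ord j0)) // exprD (prim_expr_order wp) mulr1.
  - by rewrite unitfE -normc_gt0 normcX (normc_prim_root wp) expr1n.
  - by rewrite unitfE.
have -> : nm ((w ^+ (j + (p - j0))) ^ b i - 1) = nm ((w ^+ j) ^ b i - (w ^+ j0) ^ b i).
  by rewrite -E -[X in _ = nm (_ - X)]mul1r -mulrBl Normc.normcM w1 mulr1.
move/ffunP: jc => /(_ i); rewrite !ffunE => -[cR cI].
have [R1 I1] := ReIm_le1 (w1 j i); have [R2 I2] := ReIm_le1 (w1 j0 i).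
apply: le_trans (normc_le_ReIm _) _; apply: le_trans KP.
have := coP _ _ R1 R2 cR; have := coP _ _ I1 I2 cI.
move: ((w ^+ j) ^ b i) ((w ^+ j0) ^ b i) => [x y] [x' y'] /=; lra.
Qed.

End Recurrence.

Section Gap.
Variables (R : realType) (k : nat).
Implicit Types (c : 'I_k -> R[i]) (r : pred 'rV[int]_k) (b : 'I_k -> int).
Local Notation nm := (@Normc.normc R).

(* The generic polynomial is the average of the twists of its specialisation by the
   characters trivial on [r] but not on [r']. *)
Lemma mahler_approx_specialise c r r' (s y h : R) :
  approximable r -> distinct r -> approximable r' -> distinct r' ->
  (forall v, r v -> r' v) -> l1norm c <= 1 -> 0 < h -> (exists i, h <= nm (c i)) ->
  (forall i, c i != 0 -> 0 <= s + ln (nm (c i))) ->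
  0 < y -> (forall N, y <= s + mahler_approx c r' N) ->
  exists2 e : R, 0 < e & exists N, forall M, (N <= M)%N -> e <= s + mahler_approx c r M.
Proof.
move=> rA rD rA' rD' rr' c1 h0 [i0 hi0] sc y0 Hy.
have y4 : 0 < y / 4 by rewrite divr_gt0.
have [N HN] := mahler_approx_tail k h0 y4.
(* Passing from order M down to N costs y/4, and twisting by a character within rho of 1 costs N rho
   <= y/4 at order N; y/2 remains. *)
pose rho : R := y / (4 * (N%:R + 1)).
have N0 : 0 <= N%:R :> R by [].
have rho0 : 0 < rho by rewrite divr_gt0 // mulr_gt0 //; lra.
have Nrho : N%:R * rho <= y / 4.
  have N1 : 0 < N%:R + 1 :> R by lra.
  have -> : N%:R * rho = y / 4 * (N%:R / (N%:R + 1)).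
    by rewrite /rho; field; rewrite gt_eqF.
  apply: ler_piMr; first exact: ltW.
  by rewrite ler_pdivrMr //; lra.
have [Q Q0 HQ] := recurrence k rho0.
have Q0' : 0 < Q%:R :> R by rewrite ltr0n.
exists (Q%:R^-1 * (y / 2)); first by rewrite mulr_gt0 ?invr_gt0 // divr_gt0.
exists N => M NM; have [b [p [w [_ Pp wp mod]]]] := approximableP R rA M 0.
have p0 : 0 < p%:R :> R by rewrite ltr0n prime_gt0.
have w1 (j : nat) : nm (w ^+ j) = 1 by rewrite normcX (normc_prim_root wp) expr1n.
pose J (j : 'I_p) L := mahler_approx (twist c b (w ^+ j)) r' L.
have tw j i : nm (twist c b (w ^+ j) i) = nm (c i).
  by rewrite Normc.normcM normcXz w1 exp1rz mulr1.
have tw1 (j : 'I_p) : l1norm (twist c b (w ^+ j)) <= 1 by rewrite l1norm_twist.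
(* As [r] is contained in [r'], up to order M it is cut out of [r'] by the characters attached to
   b. *)
have avg : mahler_approx c r M = p%:R^-1 * \sum_j J j M.
  rewrite /J /mahler_approx -mulr_sumr mulrCA; congr (_ * _).
  rewrite exchange_big mulr_sumr /=; apply: eq_bigr => n _.
  rewrite -mulr_suml mulrA (@defect_mean_twist_avg R k c b r' r n.+1 p w) // => t.
  have := mod n.+1 (ltn_ord n) t; case: (boolP (r _)) => [/rr' -> //|_ <-].
  by rewrite andbF.
(* Jensen's inequality for each twist, which has the same coefficient moduli as [c]. *)
have J0 (j : 'I_p) : 0 <= s + J j M.
  have [] := @mahler_approx_ge R k (twist c b (w ^+ j)) r' M rA' rD' (tw1 j).
    by exists i0; rewrite -normc_gt0 tw; exact: lt_le_trans hi0.
  move=> i; rewrite -normc_gt0 tw normc_gt0 => /sc ci; rewrite -/(J j M); lra.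
have JN (j : 'I_p) : near1 b w rho j -> y / 2 <= s + J j M.
  move=> /forallP nj.
  have h1 : J j N - y / 4 <= J j M by apply: (HN r' _ i0) => //; rewrite tw.
  have := mahler_approx_lipschitz N rA' (tw1 j) c1; rewrite ler_norml => /andP[h2 _].
  have : N%:R * \sum_i nm (twist c b (w ^+ j) i - c i) <= N%:R * rho.
    apply: ler_wpM2l => //; apply: le_trans (_ : \sum_i nm (c i) * rho <= _).
      apply: ler_sum => i _; rewrite /twist -[X in _ - X]mulr1 -mulrBr Normc.normcM.
      by apply: ler_wpM2l; [exact: normc_ge0|exact: nj].
    by rewrite -mulr_suml ler_piMl // ltW.
  have := Hy N; rewrite -/(J j N) in h2 *; lra.
have S : (y / 2) * #|[pred j : 'I_p | near1 b w rho j]|%:R <= \sum_j (s + J j M).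
  rewrite mulr_natr -sumr_const big_mkcond /=; apply: ler_sum => j _.
  by rewrite inE; case: ifP => [/JN|].
have sE : s + mahler_approx c r M = p%:R^-1 * \sum_j (s + J j M).
  rewrite big_split /= sumr_const card_ord mulrDr -avg -[s *+ p]mulr_natl mulKf //.
  by rewrite gt_eqF.
rewrite sE; apply: le_trans (ler_wpM2l _ S); last by rewrite invr_ge0 ltW.
have : p%:R <= Q%:R * #|[pred j : 'I_p | near1 b w rho j]|%:R :> R by rewrite -natrM ler_nat HQ.
move: #|_| => m pQ; rewrite ler_pdivrMl // mulrCA ler_pdivlMl //.
rewrite (mulrCA Q%:R) [leLHS]mulrC; apply: ler_wpM2l => //.
by rewrite divr_ge0 // ltW.
Qed.

End Gap.

(** * Limits along ultrafilters *)

Lemma mem_bounded_ints (z : int) (B : nat) : (`|z| <= B)%N ->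
  z \in [seq n%:Z | n <- iota 0 B.+1] ++ [seq - n%:Z | n <- iota 0 B.+1].
Proof.
rewrite mem_cat; case: z => n nB.
  by apply/orP; left; apply/mapP; exists n; rewrite ?mem_iota.
apply/orP; right; apply/mapP; exists n.+1; last by rewrite NegzE.
by rewrite mem_iota.
Qed.

Lemma ultra_mem_seq (X : Type) (T : eqType) (G : set_system X) (f : X -> T) (s : seq T) :
  UltraFilter G -> G [set x | f x \in s] -> exists t, G [set x | f x = t].
Proof.
move=> GU; elim: s => [|t s IH] H.
  by have [x] := @filter_ex _ G _ _ H; rewrite /= in_nil.
have [Gt|Gt] := in_ultra_setVsetC [set x | f x = t] GU; first by exists t.
apply: IH; apply: filterS (filterI H Gt) => x [] /=.
by rewrite in_cons => /predU1P[].
Qed.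

Lemma filter_seq (X : Type) (T : eqType) (G : set_system X) (P : T -> set X) (s : seq T) :
  Filter G -> (forall t, t \in s -> G (P t)) -> G [set x | forall t, t \in s -> P t x].
Proof.
move=> GF; elim: s => [|t s IH] H; first by apply: filterS filterT => x _ t.
have Gt : G (P t) by apply: H; rewrite mem_head.
have Gs : G [set x | forall t, t \in s -> P t x].
  by apply: IH => u us; apply: H; rewrite in_cons us orbT.
apply: filterS (filterI Gt Gs) => x [xt xs] u; rewrite in_cons => /predU1P[->//|].
exact: xs.
Qed.

(** * The set of values: closedness and isolation of 0 *)

Section Values.
Variables (R : realType) (k : nat).
Implicit Types (c : 'I_k -> int) (r : pred 'rV[int]_k).
Local Notation nm := (@Normc.normc R).

Definition height_sum c : R := \sum_i `|c i|%:~R.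

Definition unit_coef c (i : 'I_k) : R[i] := (((c i)%:~R / height_sum c)%:C)%C.

Definition nonzero c := exists i, c i != 0.

Definition lattice r := saturated r /\ distinct r.

Definition approx c r N : R := ln (height_sum c) + mahler_approx (unit_coef c) r N.

(** The Mahler measures, parametrised by k integer coefficients and an abstract relation lattice, so
    that the number of variables no longer appears. *)
Definition value_set : set R :=
  [set y | exists c r, [/\ nonzero c, lattice r & approx c r N @[N --> \oo] --> y]].

Lemma lattice_approximable r : lattice r -> approximable r.
Proof.
by move=> [/saturated_relations[B ->] _]; exact: relations_approximable.
Qed.

Lemma height_sum_ge c i : `|c i|%:~R <= height_sum c.
Proof. by rewrite /height_sum (bigD1 i) //= lerDl sumr_ge0 // => j _; rewrite ler0z. Qed.

Lemma intr_norm_ge1 (z : int) : z != 0 -> 1 <= `|z|%:~R :> R.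
Proof. by move=> z0; rewrite -[1]/(1%:~R) ler_int -gtz0_ge1 normr_gt0. Qed.

Lemma height_sum_ge1 c : nonzero c -> 1 <= height_sum c.
Proof. by move=> [i ci]; apply: le_trans (height_sum_ge c i); exact: intr_norm_ge1. Qed.

Lemma normc_unit_coef c i : nonzero c -> nm (unit_coef c i) = `|c i|%:~R / height_sum c.
Proof.
move=> c0; have S0 := lt_le_trans ltr01 (height_sum_ge1 c0).
by rewrite normc_real normrM [X in _ * X]gtr0_norm ?invr_gt0 // intr_norm.
Qed.

Lemma l1norm_unit_coef c : nonzero c -> l1norm (unit_coef c) <= 1.
Proof.
move=> c0; have S0 := lt_le_trans ltr01 (height_sum_ge1 c0).
rewrite /l1norm; under eq_bigr do rewrite normc_unit_coef //.
by rewrite -mulr_suml divff // gt_eqF.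
Qed.

Lemma unit_coef_eq0 c i : nonzero c -> (unit_coef c i != 0) = (c i != 0).
Proof.
move=> c0; have S0 := lt_le_trans ltr01 (height_sum_ge1 c0).
by rewrite -normc_gt0 normc_unit_coef // pmulr_lgt0 ?invr_gt0 // ltr0z normr_gt0.
Qed.

(** The k moduli sum to 1. This supplies the lower bound h of [mahler_approx_tail] uniformly in
    [c]. *)
Lemma unit_coef_large c : nonzero c -> exists i, k%:R^-1 <= nm (unit_coef c i).
Proof.
move=> c0; have S0 := lt_le_trans ltr01 (height_sum_ge1 c0).
have [i0 _] := c0; have k0 : 0 < k%:R :> R by rewrite ltr0n; case: (k) i0 => [[]|].
apply: contrapT => /forallNP H.
have : \sum_i nm (unit_coef c i) < 1.
  apply: lt_le_trans (_ : \sum_(i < k) k%:R^-1 <= _).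
    apply: ltr_sum; first by apply/hasP; exists i0; rewrite ?mem_index_enum.
    by move=> i _; rewrite ltNge; apply/negP; exact: H.
  by rewrite sumr_const card_ord -[_ *+ k]mulr_natl divff // gt_eqF.
under eq_bigr do rewrite normc_unit_coef //.
by rewrite -mulr_suml divff ?gt_eqF // ltxx.
Qed.

Lemma ln_unit_coef_ge0 c i : nonzero c -> unit_coef c i != 0 ->
  0 <= ln (height_sum c) + ln (nm (unit_coef c i)).
Proof.
move=> c0; rewrite unit_coef_eq0 // => ci.
have S0 := lt_le_trans ltr01 (height_sum_ge1 c0).
have c1 := intr_norm_ge1 ci; have c1' := lt_le_trans ltr01 c1.
by rewrite normc_unit_coef // ln_div ?posrE // addrC subrK ln_ge0.
Qed.

Lemma approx_ge0 c r N : nonzero c -> lattice r -> 0 <= approx c r N.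
Proof.
move=> c0 rL; have [|i ci H] := mahler_approx_ge N (lattice_approximable rL) rL.2 (l1norm_unit_coef c0).
  by have [i ci] := c0; exists i; rewrite unit_coef_eq0.
by have := ln_unit_coef_ge0 c0 ci; rewrite /approx; lra.
Qed.

Lemma approx_nonincreasing c r : nonzero c -> lattice r ->
  {homo approx c r : N M / (N <= M)%N >-> M <= N}.
Proof.
move=> c0 rL N M NM; rewrite lerD2l.
exact: (mahler_approx_nonincreasing (lattice_approximable rL) (l1norm_unit_coef c0)).
Qed.

Lemma approx_cvg c r : nonzero c -> lattice r -> exists y : R, approx c r N @[N --> \oo] --> y.
Proof.
move=> c0 rL; exists (lim (approx c r N @[N --> \oo])).
apply: nonincreasing_is_cvgn; first by move=> N M NM; exact: approx_nonincreasing.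
by exists 0 => _ [N _ <-]; exact: approx_ge0.
Qed.

Lemma limit_le_approx c r y N : nonzero c -> lattice r ->
  approx c r N @[N --> \oo] --> y -> y <= approx c r N.
Proof.
move=> c0 rL cy; have <- : lim (approx c r N @[N --> \oo]) = y by exact: cvg_lim.
apply: nonincreasing_cvgn_ge; first by move=> n m; exact: approx_nonincreasing.
by apply/cvg_ex; exists y.
Qed.

Lemma limit_ge0 c r y : nonzero c -> lattice r ->
  approx c r N @[N --> \oo] --> y -> 0 <= y.
Proof.
move=> c0 rL cy; have <- : lim (approx c r N @[N --> \oo]) = y by exact: cvg_lim.
apply: limr_ge; first by apply/cvg_ex; exists y.
by near=> N; exact: approx_ge0.
Unshelve. all: by end_near. Qed.

Lemma approx_tail (eps : R) : 0 < eps -> exists N, forall c r y, nonzero c -> lattice r ->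
  approx c r N @[N --> \oo] --> y -> approx c r N - eps <= y.
Proof.
move=> e0; have [k0|k0] := posnP k.
  by exists 0%N => c r y [i0 _]; have := leq_ltn_trans (leq0n _) (ltn_ord i0); rewrite {1}k0.
have h0 : 0 < k%:R^-1 :> R by rewrite invr_gt0 ltr0n.
have [N HN] := mahler_approx_tail k h0 e0; exists N => c r y c0 rL cy.
have [i hi] := unit_coef_large c0.
have <- : lim (approx c r N @[N --> \oo]) = y by exact: cvg_lim.
apply: limr_ge; first by apply/cvg_ex; exists y.
exists N => // M NM /=; rewrite /approx -addrA lerD2l.
by apply: (HN _ _ i) => //; [exact: lattice_approximable|exact: rL.2|exact: l1norm_unit_coef].
Qed.

(** At the order N where the tail is at most 1, y >= ln S - N - 1 for S the sum of the |c_i|, so a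
    bound on y bounds S. *)
Lemma height_bound (x : R) : exists B : nat, forall c r y, nonzero c -> lattice r ->
  approx c r N @[N --> \oo] --> y -> y <= x -> forall i, (`|c i| <= B)%N.
Proof.
have [N HN] := approx_tail ltr01.
exists (Num.truncn (expR (x + N%:R + 1))) => c r y c0 rL cy yx i.
have S0 := lt_le_trans ltr01 (height_sum_ge1 c0).
have := HN c r y c0 rL cy.
have := mahler_approx_lower N (lattice_approximable rL) (l1norm_unit_coef c0).
rewrite /approx => h1 h2; rewrite truncn_ge_nat ?expR_ge0 //.
apply: le_trans (_ : height_sum c <= _).
  by apply: le_trans (height_sum_ge c i); rewrite -abszE.
by rewrite -[leLHS]lnK ?posrE // ler_expR; lra.
Qed.

Lemma eq_approx c r r' N :
  (forall n, (n <= N)%N -> defect_mean (unit_coef c) r n = defect_mean (unit_coef c) r' n) ->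
  approx c r N = approx c r' N.
Proof.
move=> E; congr (_ + _ * _); apply: eq_bigr => n _.
by rewrite E.
Qed.

Lemma ultra_limit (G : set_system R) (x : R) (c_ : R -> 'I_k -> int)
    (r_ : R -> pred 'rV[int]_k) :
  UltraFilter G -> nbhs x `<=` G ->
  G [set y | [/\ nonzero (c_ y), lattice (r_ y) &
               approx (c_ y) (r_ y) N @[N --> \oo] --> y]] ->
  exists c r, [/\ nonzero c, lattice r, approx c r N @[N --> \oo] --> x,
    G [set y | c_ y = c] & forall v, G [set y | r_ y v = r v]].
Proof.
move=> GU Gx GA.
have Gle : G [set y | y <= x + 1].
  by apply: Gx; apply: (lt_le_nbhsl (_ : x < x + 1)); rewrite ltrDl.
have [B HB] := height_bound (x + 1).
have Gc i : exists z, G [set y | c_ y i = z].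
  apply: (@ultra_mem_seq _ _ G (fun y => c_ y i)
    ([seq n%:Z | n <- iota 0 B.+1] ++ [seq - n%:Z | n <- iota 0 B.+1])) => //.
  apply: filterS (filterI GA Gle) => y [[c0 rL cy] yx].
  exact/mem_bounded_ints/(HB _ _ y c0 rL cy yx i).
have [c cP] := choice Gc.
have Gcc : G [set y | c_ y = c].
  have : G [set y | forall i, i \in enum 'I_k -> c_ y i = c i] by apply: filter_seq => i _; exact: cP.
  by apply: filterS => y H; apply/funext => i; apply: H; rewrite mem_enum.
(* The limit lattice contains the vectors lying in [r_ y] for G-almost all y. The lattice axioms
   each involve finitely many vectors, so they survive. *)
pose r : pred 'rV[int]_k := fun v => `[< G [set y | r_ y v] >].
have Gr v : G [set y | r_ y v = r v].
  have [H|H] := in_ultra_setVsetC [set y | r_ y v] GU.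
    have rv : r v by apply/asboolP.
    by apply: filterS H => y /= ->.
  have rv : r v = false.
    apply/asboolPn => H'; have [y [/= h1 h2]] := @filter_ex _ G _ _ (filterI H H').
    exact: h1.
  by apply: filterS H => y /= /negP/negbTE ->.
have rL : lattice r.
  have GL : G [set y | lattice (r_ y)] by apply: filterS GA => y [].
  split; first split.
  - by apply/asboolP; apply: filterS GL => y [[]].
  - move=> u v /asboolP Gu /asboolP Gv; apply/asboolP.
    by apply: filterS (filterI GL (filterI Gu Gv)) => y [[[_ rB _] _] [ru rv]]; exact: rB.
  - move=> n v n0 /asboolP Gv; apply/asboolP.
    by apply: filterS (filterI GL Gv) => y [[[_ _ rN] _] rv]; exact: rN n0 rv.
  - move=> i j ij; apply/asboolPn => H.
    have [y [/= [_ rD] ry]] := @filter_ex _ G _ _ (filterI GL H).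
    by have := rD i j ij; rewrite ry.
have c0 : nonzero c.
  by have [y [/= [c0 _ _] <-]] := @filter_ex _ G _ _ (filterI GA Gcc).
have [z cz] := approx_cvg c0 rL.
(* A fixed mean tests finitely many vectors, on which [r_ y] and [r] agree for G-almost all y. *)
have Gm n : G [set y | defect_mean (unit_coef c) (r_ y) n = defect_mean (unit_coef c) r n].
  have : G [set y | forall s, s \in enum {: {ffun 'I_n -> option ('I_k * 'I_k)}} ->
      r_ y (exp_vec s) = r (exp_vec s)] by apply: filter_seq => s _; exact: Gr.
  by apply: filterS => y H; apply: eq_defect_mean => s; apply: H; rewrite mem_enum.
have Ga N : G [set y | approx c (r_ y) N = approx c r N].
  have : G [set y | forall n, n \in iota 0 N.+1 ->
      defect_mean (unit_coef c) (r_ y) n = defect_mean (unit_coef c) r n].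
    by apply: filter_seq => n _; exact: Gm.
  by apply: filterS => y H; apply: eq_approx => n nN; apply: H; rewrite mem_iota.
(* At a uniform order N, both z and some y close to x are within eps/3 of the same approximation, so
   z is the limit x. *)
suff zx : z = x by exists c, r; rewrite -zx.
apply/eqP; rewrite -subr_eq0 -normr_le0; apply/ler_addgt0Pr => eps eps0; rewrite add0r.
have e3 : 0 < eps / 3 by rewrite divr_gt0.
have [N HN] := approx_tail e3.
have Gxe : G [set y | `|x - y| <= eps / 3] by apply: Gx; apply/nbhs_ballP; exists (eps / 3) => // y /ltW.
have [y [/= [[[c0' rL' cy] cE] aE] xy]] :=
  @filter_ex _ G _ _ (filterI (filterI (filterI GA Gcc) (Ga N)) Gxe).
have h1 := HN _ _ _ c0' rL' cy; have h2 := limit_le_approx N c0' rL' cy.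
have h3 := HN _ _ _ c0 rL cz; have h4 := limit_le_approx N c0 rL cz.
rewrite cE aE in h1 h2; move: xy; rewrite !ler_norml => /andP[x1 x2].
by apply/andP; split; lra.
Qed.

Lemma exists_value_data : exists c_ : R -> 'I_k -> int, exists r_ : R -> pred 'rV[int]_k,
  forall y, value_set y ->
    [/\ nonzero (c_ y), lattice (r_ y) & approx (c_ y) (r_ y) N @[N --> \oo] --> y].
Proof.
have H y : exists cr : ('I_k -> int) * pred 'rV[int]_k, value_set y ->
    [/\ nonzero cr.1, lattice cr.2 & approx cr.1 cr.2 N @[N --> \oo] --> y].
  have [[c [r H]]|ny] := pselect (value_set y); first by exists (c, r).
  (* A dummy value where there is no data. *)
  by exists (fun=> 0, xpredT).
have [f fP] := choice H; by exists (fun y => (f y).1), (fun y => (f y).2).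
Qed.

Lemma value_set_ge0 : value_set `<=` [set x | 0 <= x].
Proof. by move=> y [c [r [c0 rL cy]]]; exact: limit_ge0 cy. Qed.

Lemma closed_value_set : closed value_set.
Proof.
move=> x clx; have FF : ProperFilter (within value_set (nbhs x)) by exact: within_nbhs_proper.
have [G [GU FG]] := ultraFilterLemma FF.
have [c_ [r_ H]] := exists_value_data.
have [||c [r [c0 rL cx _ _]]] := @ultra_limit G x c_ r_ GU.
- by move=> V xV; apply: FG; apply: filterS xV.
- by apply: filterS (FG _ (withinT _ _)) => y yA; exact: H.
by exists c, r.
Qed.

(** A single monomial with coefficient 1, the other coefficients being 0; the identity matrix gives
    k independent exponents. *)
Lemma value_set0 : (0 < k)%N -> value_set 0.
Proof.
move=> k0; pose i0 := Ordinal k0.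
pose c (i : 'I_k) : int := (i == i0)%:R; exists c, (relations (1%:M : 'M[int]_k)).
have c0 : nonzero c by exists i0; rewrite /c eqxx.
have rL : lattice (relations (1%:M : 'M[int]_k)).
  split; first exact: relations_saturated.
  move=> i j ij; rewrite /relations mulmx1 subr_eq0; apply/eqP => /rowP /(_ i).
  by rewrite !mxE !eqxx /= (negPf ij).
split => //; suff -> : approx c (relations 1%:M) = cst 0 by exact: cvg_cst.
apply/funext => N; rewrite /approx /mahler_approx.
have S1 : height_sum c = 1.
  rewrite /height_sum (bigD1 i0) //= big1 ?addr0 => [|i ii0]; first by rewrite /c eqxx normr1.
  by rewrite /c (negPf ii0) normr0.
rewrite S1 ln1 add0r big1 ?mulr0 // => n _.
rewrite (@defect_mean_single _ _ _ _ i0 _ (lattice_approximable rL) (l1norm_unit_coef c0)).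
  by rewrite normc_unit_coef // S1 /c eqxx normr1 divr1 expr1n subrr expr0n mul0r.
by move=> i ii0; rewrite /unit_coef /c (negPf ii0) mul0r.
Qed.

Lemma value_set_isolated : (0 < k)%N -> isolated value_set 0.
Proof.
move=> k0; split; first by apply/mem_set; exact: value_set0.
apply: contrapT => nV.
(* If 0 is not isolated, an ultrafilter of nonzero values converges to it. *)
have cl0 : closure (value_set `\ 0) 0.
  move=> V V0; apply: contrapT => /forallNP H; apply: nV; exists V => //.
  apply/seteqP; split => [y [Vy Ay]|_ ->]; last first.
    by split; [exact: nbhs_singleton|exact: value_set0].
  by apply: contrapT => y0; apply: (H y).
have FF : ProperFilter (within (value_set `\ 0) (nbhs 0)) by exact: within_nbhs_proper.
have [G [GU FG]] := ultraFilterLemma FF.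
have [c_ [r_ H]] := exists_value_data.
have GA0 : G (value_set `\ 0) by apply: FG; exact: withinT.
have GA : G [set y | [/\ nonzero (c_ y), lattice (r_ y) &
    approx (c_ y) (r_ y) N @[N --> \oo] --> y]].
  by apply: filterS GA0 => y [yA _]; exact: H.
have [|c [r [c0 rL cx Gc Gr]]] := @ultra_limit G 0 c_ r_ GU _ GA.
  by move=> V xV; apply: FG; apply: filterS xV.
(* Finite generation provides one nonzero value y with the limit coefficients and a lattice [r_ y]
   containing [r]; specialisation then makes the limit measure positive. *)
have [V [Vr VP]] := saturated_generators rL.1.
have GV : G [set y | forall v, v \in V -> r_ y v].
  by apply: filter_seq => v vV; apply: filterS (Gr v) => y /= ->; exact: Vr.
have [y [/= [[c0' rL' cy] [yA y0]] [Vy cE]]] :=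
  @filter_ex _ G _ _ (filterI (filterI GA GA0) (filterI GV Gc)).
rewrite cE in c0' cy.
have rr' v : r v -> r_ y v by apply: VP => //; exact: rL'.1.
have y0' : 0 < y by rewrite lt_def (value_set_ge0 yA) andbT; apply/eqP.
have kV : 0 < k%:R^-1 :> R by rewrite invr_gt0 ltr0n.
have [e e0 [N HN]] := @mahler_approx_specialise R k (unit_coef c) r (r_ y)
  (ln (height_sum c)) y k%:R^-1 (lattice_approximable rL) rL.2
  (lattice_approximable rL') rL'.2 rr' (l1norm_unit_coef c0) kV (unit_coef_large c0)
  (fun i => ln_unit_coef_ge0 c0) y0' (fun N => limit_le_approx N c0 rL' cy).
have : e <= 0.
  have <- : lim (approx c r N @[N --> \oo]) = 0 by exact: cvg_lim.
  apply: limr_ge; first by apply/cvg_ex; exists 0.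
  by exists N => // M; exact: HN.
by rewrite leNgt e0.
Qed.

End Values.

(** * Iterated integrals *)

Section Expi2pi.
Variable R : realType.
Local Notation nm := (@Normc.normc R).

Lemma expi2piD (s t : R) : expi2pi (s + t) = expi2pi s * expi2pi t.
Proof.
rewrite /expi2pi mulrDr cosD sinD.
by apply/eqP; rewrite eq_complex /=; apply/andP; split; apply/eqP; ring.
Qed.

Lemma expi2pi0 : expi2pi (0 : R) = 1.
Proof. by rewrite /expi2pi mulr0 cos0 sin0. Qed.

Lemma normc_expi2pi (t : R) : nm (expi2pi t) = 1.
Proof. by rewrite /expi2pi /= cos2Dsin2 sqrtr1. Qed.

Lemma expi2pi_neq0 (t : R) : expi2pi t != 0.
Proof. by rewrite -normc_gt0 normc_expi2pi. Qed.

Lemma expi2piXz (t : R) (m : int) : expi2pi t ^ m = expi2pi (m%:~R * t).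
Proof.
have H (n : nat) : expi2pi t ^+ n = expi2pi (n%:R * t).
  elim: n => [|n IH]; first by rewrite mul0r expi2pi0.
  by rewrite exprS IH -expi2piD -natr1 mulrDl mul1r addrC.
case: m => n; first exact: H.
rewrite /exprz H NegzE mulrNz mulNr.
by apply: (mulfI (expi2pi_neq0 (n.+1%:R * t))); rewrite mulfV ?expi2pi_neq0 // -expi2piD subrr expi2pi0.
Qed.

Lemma expi2pi_int (m : int) : expi2pi (m%:~R : R) = 1.
Proof.
rewrite -[m%:~R]mulr1 -expi2piXz.
suff -> : expi2pi (1 : R) = 1 by rewrite exp1rz.
have -> : 1 = 1 / 2 + 1 / 2 :> R by field.
rewrite expi2piD /expi2pi.
have -> : 2 * pi * (1 / 2) = pi :> R by field.
by rewrite cospi sinpi; apply/eqP; rewrite eq_complex /= !mulr0 !mul0r !mulrNN mulr1 subr0 addr0 !eqxx.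
Qed.

End Expi2pi.

(** * Integrals and monotone limits over the unit interval *)

Section UnitInterval.
Variable R : realType.
Local Notation mu := (@lebesgue_measure R).
Local Notation T := (measurableTypeR R).
Local Notation D := (`[0%R, 1%R]%classic : set T).

Lemma integral_cst_unit (K : R) : (\int[mu]_(t in D) K%:E = K%:E)%E.
Proof.
rewrite integral_cst //= lebesgue_measure_itv /= lte_fin ltr01.
by rewrite -EFinD subr0 mule1.
Qed.

Lemma adde_sub_eq (a b v : \bar R) (K : R) : a \is a fin_num ->
  (a + v = K%:E + b -> a - b = K%:E - v)%E.
Proof.
case: a => // a _; case: v => [v| |]; case: b => [b| |] //=.
by rewrite -!EFinD => -[h]; congr EFin; lra.
Qed.

(** The integral of V may be infinite, so linearity is applied to nonnegative functions only,
    through f^+ + V = K + f^- for f = K - V, where f^+ <= K. *)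
Lemma integral_cst_sub (K : R) (V : T -> \bar R) : 0 <= K -> measurable_fun D V ->
  (forall t, D t -> (0 <= V t)%E) ->
  (\int[mu]_(t in D) (K%:E - V t) = K%:E - \int[mu]_(t in D) V t)%E.
Proof.
move=> K0 mV V0; pose f t := (K%:E - V t)%E.
have mD : measurable D by exact: measurable_itv.
have mf : measurable_fun D f by apply: emeasurable_funB => //; exact: measurable_cst.
have fE t : D t -> (f^\+ t + V t = K%:E + f^\- t)%E.
  move=> Dt; rewrite funeposE funenegE /f; case: (V t) (V0 t Dt) => [r r0||] //=.
    rewrite -EFinD; have [h|h] := leP (K - r) 0.
      by rewrite max_r ?lee_fin // max_l ?lee_fin ?oppr_ge0 // -!EFinD; congr EFin; ring.
    rewrite max_l ?lee_fin ?ltW // max_r ?lee_fin ?oppr_le0 ?ltW // -!EFinD.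
    by congr EFin; ring.
  by move=> _; rewrite addeNy max_r ?leNye // max_l ?leey.
have fp : (\int[mu]_(t in D) f^\+ t <= K%:E)%E.
  rewrite -[leRHS]integral_cst_unit.
  apply: ge0_le_integral => //.
  - exact: measurable_funepos.
  - move=> t Dt; rewrite funeposE ge_max lee_fin K0 andbT /f.
    by rewrite -[leRHS]adde0 leeD2l // leeNl oppe0 V0.
rewrite integralE; apply: adde_sub_eq.
  by rewrite ge0_fin_numE ?(le_lt_trans fp) ?ltry // integral_ge0.
rewrite -ge0_integralD //; last exact: measurable_funepos.
transitivity (\int[mu]_(t in D) (K%:E + f^\- t))%E.
  by apply: eq_integral => t; rewrite inE => Dt; exact: fE.
rewrite ge0_integralD //; last exact: measurable_funeneg.
by rewrite integral_cst_unit.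
Qed.

(** Monotone convergence for the nonnegative increasing sequence K - g_N; the limit may take the
    value -oo. *)
Lemma nonincreasing_integral_cvg (g : nat -> T -> R) (G : T -> \bar R) (K : R) :
  0 <= K -> (forall N, measurable_fun D (g N)) -> (forall N t, g N t <= K) ->
  (forall t, {homo g ^~ t : N M / (N <= M)%N >-> M <= N}) ->
  (forall t, D t -> (g N t)%:E @[N --> \oo] --> G t) ->
  (\int[mu]_(t in D) (g N t)%:E)%E @[N --> \oo] --> (\int[mu]_(t in D) G t)%E.
Proof.
move=> K0 mg gK gN gG; pose V N t := (K - g N t)%:E.
have mD : measurable D by exact: measurable_itv.
have V0 N t : (0 <= V N t)%E by rewrite lee_fin subr_ge0.
have mV N : measurable_fun D (V N).
  apply/measurable_EFinP; apply: measurable_funB => //; exact: measurable_cst.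
have VG t : D t -> V N t @[N --> \oo] --> (K%:E - G t)%E.
  move=> Dt; rewrite (_ : V ^~ t = fun N => (K%:E - (g N t)%:E)%E) //.
  by apply: cvgeB; [rewrite fin_num_adde_defr|exact: cvg_cst|exact: gG].
have /= H := @cvg_monotone_convergence _ _ R mu D mD V mV (fun N t _ => V0 N t) _.
have gE N : (\int[mu]_(t in D) (g N t)%:E = K%:E - \int[mu]_(t in D) V N t)%E.
  rewrite -integral_cst_sub //; apply: eq_integral => t _.
  by rewrite /V -EFinB subKr.
have GE : (\int[mu]_(t in D) G t = K%:E - \int[mu]_(t in D) (K%:E - G t))%E.
  rewrite -integral_cst_sub //.
  - apply: eq_integral => t _; case: (G t) => [r||] //.
    by rewrite -!EFinB subKr.
  - by apply: (emeasurable_fun_cvg V) => // t Dt; exact: VG.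
  - move=> t Dt; have <- := cvg_lim (@ereal_hausdorff R) (VG t Dt).
    apply: lime_ge; first by apply/cvg_ex; exists (K%:E - G t)%E; exact: VG.
    by apply: nearW => N; exact: V0.
rewrite GE; under eq_cvg do rewrite gE.
apply: cvgeB; [by rewrite fin_num_adde_defr|exact: cvg_cst|].
have -> : (\int[mu]_(t in D) (K%:E - G t))%E = (\int[mu]_(t in D) limn (V ^~ t))%E.
  by apply: eq_integral => t; rewrite inE => Dt; apply/esym/cvg_lim => //; exact: VG.
apply: H => t _ N M NM; rewrite lee_fin lerD2l lerN2; exact: gN.
Qed.

(** An explicit antiderivative makes the mean stable under linear combinations and computable by the
    fundamental theorem of calculus. *)
Definition has_mean (h : R -> R) (v : R) := continuous h /\
  exists2 H : R -> R, (forall t : R, is_derive t 1 H (h t)) & H 1 - H 0 = v.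

Lemma has_mean_integral h v : has_mean h v -> (\int[mu]_(t in D) (h t)%:E)%E = v%:E.
Proof.
move=> [ch [H dH <-]]; rewrite (@continuous_FTC2 R h H) //.
- exact: continuous_subspaceT.
- have cH : continuous H.
    by move=> t; apply/differentiable_continuous/derivable1_diffP; exact: ex_derive.
  split; [by move=> t _; exact: ex_derive|apply: cvg_at_right_filter|apply: cvg_at_left_filter]; exact: cH.
- by move=> t _; rewrite derive1E; apply: derive_val.
Qed.

Lemma has_mean_measurable h v : has_mean h v -> measurable_fun D (h : T -> R).
Proof. by move=> [ch _]; apply: measurable_funTS; exact: continuous_measurable_fun. Qed.

Lemma has_meanD h1 v1 h2 v2 : has_mean h1 v1 -> has_mean h2 v2 ->
  has_mean (fun t => h1 t + h2 t) (v1 + v2).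
Proof.
move=> [c1 [H1 d1 e1]] [c2 [H2 d2 e2]]; split.
  by move=> t; apply: cvgD; [exact: c1|exact: c2].
exists (H1 + H2) => [t|]; first exact: is_deriveD.
by rewrite -e1 -e2 /= !fctE; ring.
Qed.

Lemma has_meanZ h v (k : R) : has_mean h v -> has_mean (fun t => k * h t) (k * v).
Proof.
move=> [c [H d e]]; split.
  by move=> t; apply: cvgM; [exact: cvg_cst|exact: c].
exists (k *: (H : R -> R^o)) => [t|]; first exact: is_deriveZ.
by rewrite -e /= !fctE; rewrite /GRing.scale /=; ring.
Qed.

Lemma has_mean_cst (k : R) : has_mean (fun=> k) k.
Proof.
split; first by move=> t; exact: cvg_cst.
exists (fun t => k * t) => [t|]; last by ring.
have := @is_deriveZ R R^o R^o id k t 1 1 _.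
by rewrite /GRing.scale /= mulr1; apply.
Qed.

Lemma has_mean_sum (I : Type) (s : seq I) (P : pred I) (h : I -> R -> R) (v : I -> R) :
  (forall i, has_mean (h i) (v i)) ->
  has_mean (fun t => \sum_(i <- s | P i) h i t) (\sum_(i <- s | P i) v i).
Proof.
move=> H; elim: s => [|i s IH].
  rewrite big_nil (_ : (fun t => _) = fun=> 0); first exact: has_mean_cst.
  by apply/funext => t; rewrite big_nil.
rewrite big_cons (_ : (fun t => _) = fun t =>
    if P i then h i t + \sum_(j <- s | P j) h j t else \sum_(j <- s | P j) h j t).
  by case: (P i); [exact: has_meanD|].
by apply/funext => t; rewrite big_cons.
Qed.

Lemma has_mean_cos_sin (x y a : R) (m : int) : a = 2 * pi * m%:~R ->
  has_mean (fun t => x * cos (a * t) - y * sin (a * t)) (if m == 0 then x else 0).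
Proof.
move=> aE; case: eqVneq => [m0|m0].
  rewrite aE m0 mulr0 (_ : (fun t => _) = fun=> x); first exact: has_mean_cst.
  by apply/funext => t; rewrite mul0r cos0 sin0 mulr1 mulr0 subr0.
have a0 : a != 0 by rewrite aE !mulf_neq0 ?intr_eq0 // gt_eqF // pi_gt0.
have da (t : R) : is_derive t 1 (fun t : R => a * t) a.
  have := @is_deriveZ R R^o R^o id a t 1 1 _.
  by rewrite /GRing.scale /= mulr1; apply.
have ds (t : R) : is_derive t 1 (fun t => sin (a * t)) (cos (a * t) * a).
  exact: (@is_derive1_comp R (@sin R) (fun t => a * t) t _ _ (is_derive_sin _) (da t)).
have dc (t : R) : is_derive t 1 (fun t => cos (a * t)) (- sin (a * t) * a).
  exact: (@is_derive1_comp R (@cos R) (fun t => a * t) t _ _ (is_derive_cos _) (da t)).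
split.
  move=> t; apply: (@cvgB R R^o); apply: cvgM; try exact: cvg_cst.
    by apply/differentiable_continuous/derivable1_diffP; apply: ex_derive; exact: dc.
  by apply/differentiable_continuous/derivable1_diffP; apply: ex_derive; exact: ds.
exists ((x / a) *: ((fun t => sin (a * t)) : R -> R^o) + (y / a) *: ((fun t => cos (a * t)) : R -> R^o)).
  move=> t; have := is_deriveD (@is_deriveZ _ _ _ _ (x / a) t 1 _ (ds t)) (@is_deriveZ _ _ _ _ (y / a) t 1 _ (dc t)).
  rewrite /GRing.scale /= => H; apply: (is_derive_eq H).
  by field.
have [s1 c1] : sin a = 0 /\ cos a = 1.
  by have := expi2pi_int R m; rewrite /expi2pi -aE => -[-> ->].
by rewrite !fctE !mulr1 !mulr0 sin0 cos0 s1 c1 subrr.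
Qed.

Lemma has_mean_Re_expi2pi (z : R[i]) (m : int) :
  has_mean (fun t => complex.Re (z * expi2pi t ^ m)) (if m == 0 then complex.Re z else 0).
Proof.
case: z => x y; rewrite (_ : (fun t => _) =
    fun t => x * cos (2 * pi * m%:~R * t) - y * sin (2 * pi * m%:~R * t)).
  exact: has_mean_cos_sin.
by apply/funext => t; rewrite expi2piXz /expi2pi /= !mulrA.
Qed.

End UnitInterval.

(* Stated for an arbitrary function [e], since conversion may otherwise unfold the
   trigonometric series hidden in [expi2pi]. *)
Lemma prod_exprz_rcons (K : comUnitRingType) (T : Type) (e : T -> K) l
    (a : 'I_l.+1 -> int) (s : l.-tuple T) (t : T) :
  \prod_j e (tnth [tuple of rcons s t] j) ^ a j =
  (\prod_j e (tnth s j) ^ a (widen_ord (leqnSn l) j)) * e t ^ a ord_max.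
Proof.
have E1 : tnth [tuple of rcons s t] ord_max = t.
  by rewrite (tnth_nth t) /= nth_rcons size_tuple ltnn eqxx.
have E2 j : tnth [tuple of rcons s t] (widen_ord (leqnSn l) j) = tnth s j.
  by rewrite (tnth_nth t) (tnth_nth t s) /= nth_rcons size_tuple ltn_ord.
rewrite big_ord_recr E1; congr (_ * _).
by apply: eq_bigr => j _; rewrite E2.
Qed.

(** * Iterated integrals as limits of the approximations *)

Section IteratedIntegral.
Variables (R : realType) (k : nat).
Implicit Types (c : 'I_k -> R[i]) (r : pred 'rV[int]_k) (b : 'I_k -> int).
Local Notation nm := (@Normc.normc R).

(** Integrating out one variable keeps the exponent vectors orthogonal to its column [b], which cuts
    [r] out of [r']. *)
Lemma has_mean_defect_mean c b r r' n :
  (forall v, r v = r' v && (dotz b v == 0)) ->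
  has_mean (fun t => defect_mean (twist c b (expi2pi t)) r' n) (defect_mean c r n).
Proof.
move=> rE; pose W (s : {ffun 'I_n -> option ('I_k * 'I_k)}) : R[i] :=
  (r' (exp_vec s))%:R * \prod_(i < n) term_coef c (s i).
rewrite (_ : (fun t => _) =
    fun t => \sum_s complex.Re (W s * expi2pi t ^ dotz b (exp_vec s))).
  rewrite (_ : defect_mean c r n =
      \sum_s if dotz b (exp_vec s) == 0 then complex.Re (W s) else 0).
    by apply: has_mean_sum => s; exact: has_mean_Re_expi2pi.
  rewrite /defect_mean Re_sum; apply: eq_bigr => s _; rewrite rE /W.
  by case: eqP; rewrite ?andbT // andbF mul0r.
apply/funext => t; rewrite /defect_mean Re_sum; apply: eq_bigr => s _.
by rewrite prod_term_coef_twist ?normc_expi2pi // mulrA.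
Qed.

Lemma has_mean_mahler_approx c b r r' N :
  (forall v, r v = r' v && (dotz b v == 0)) ->
  has_mean (fun t => mahler_approx (twist c b (expi2pi t)) r' N) (mahler_approx c r N).
Proof.
move=> rE; apply: has_meanZ; apply: has_mean_sum => n.
rewrite (_ : (fun t => _) =
  fun t => n.+1%:R^-1 * defect_mean (twist c b (expi2pi t)) r' n.+1); last first.
  by apply/funext => t; rewrite mulrC.
by rewrite mulrC; apply: has_meanZ; exact: has_mean_defect_mean.
Qed.

Lemma mahler_approx_predT_cvg c (S : R) : 1 <= S -> l1norm c <= 1 ->
  (ln S + mahler_approx c predT N)%:E @[N --> \oo] --> lne (S * nm (\sum_i c i))%:E.
Proof.
move=> S1 c1; have S0 : 0 < S by exact: lt_le_trans S1.
set x := nm _; have x0 : 0 <= x by exact: normc_ge0.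
have x1 : x <= 1 by exact: le_trans (normc_sum _ _ _) c1.
have E N : mahler_approx c predT N = 2^-1 * - (log_poly R N).[1 - x ^+ 2].
  rewrite /mahler_approx horner_log_poly mulrN -mulNr; congr (_ * _).
  by apply: eq_bigr => n _; rewrite defect_mean_predT.
under eq_cvg do rewrite E.
move: x0; rewrite le_eqVlt => /predU1P[<-|x0].
  rewrite mulr0 le0_lneNy // expr0n subr0; apply/cvgeNyPle => A.
  have [N HN] := log_poly1_dvg (2 * (ln S - A)).
  exists N => // M NM /=; rewrite lee_fin; have := HN M NM; lra.
rewrite lne_EFin ?mulr_gt0 // lnM ?posrE //.
apply: cvg_EFin; first by apply: nearW.
rewrite /comp /=; apply: cvgD; first exact: cvg_cst.
have -> : ln x = 2^-1 * ln (x ^+ 2) by rewrite lnXn // mulr2n; field.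
apply: cvgM; first exact: cvg_cst.
by apply: log_poly_cvg; rewrite exprn_gt0 // exprn_ile1 // ltW.
Qed.

Lemma relations_split l (A : 'M[int]_(k, l.+1)) v :
  relations A v = relations (\matrix_(i, j) A i (widen_ord (leqnSn l) j)) v &&
                  (dotz (fun i => A i ord_max) v == 0).
Proof.
rewrite /relations; apply/eqP/andP => [vA|[/eqP vA /eqP dv]].
  split; apply/eqP; [apply/rowP => j|]; rewrite ?mxE.
    have /rowP /(_ (widen_ord (leqnSn l) j)) := vA; rewrite !mxE => E; rewrite -[RHS]E.
    by apply: eq_bigr => i _; rewrite mxE.
  by have /rowP /(_ ord_max) := vA; rewrite !mxE.
apply/rowP => j; rewrite !mxE; case: (unliftP ord_max j) => [j' ->|->]; last exact: dv.
have /rowP /(_ j') := vA; rewrite !mxE => E; rewrite -[RHS]E.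
apply: eq_bigr => i _; rewrite mxE; congr (_ * A _ _).
by apply: val_inj; rewrite /= /bump leqNgt ltn_ord.
Qed.

Lemma mahler_approx_le0 c r N : approximable r -> l1norm c <= 1 -> mahler_approx c r N <= 0.
Proof.
move=> rA c1; have := mahler_approx_nonincreasing rA c1 (leq0n N).
by rewrite {2}/mahler_approx big_ord0 mulr0.
Qed.

(** Induction on the number of variables. The outermost integral runs over the last coordinate,
    whose column of A becomes a twist of the coefficients; monotone convergence exchanges limit and
    integral. With no variables left every vector is a relation. *)
Lemma iterated_integral_cvg l (A : 'M[int]_(k, l)) c (S : R) : 1 <= S -> l1norm c <= 1 ->
  (ln S + mahler_approx c (relations A) N)%:E @[N --> \oo] -->
  iterated_integral (fun t : l.-tuple R =>
    lne (S * nm (\sum_i c i * \prod_j expi2pi (tnth t j) ^ A i j))%:E).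
Proof.
elim: l A c => [|l IH] A c S1 c1.
  have -> : relations A = predT by apply/funext => v; rewrite /relations thinmx0 eqxx.
  rewrite /=; under eq_bigr do rewrite big_ord0 mulr1.
  exact: mahler_approx_predT_cvg.
pose b i := A i ord_max; pose A' := \matrix_(i, j) A i (widen_ord (leqnSn l) j).
have r'A := relations_approximable A'.
pose g N t := ln S + mahler_approx (twist c b (expi2pi t)) (relations A') N.
have tw1 t : l1norm (twist c b (expi2pi t)) <= 1 by rewrite l1norm_twist ?normc_expi2pi.
have hm N : has_mean (g N) (ln S + mahler_approx c (relations A) N).
  apply: has_meanD; first exact: has_mean_cst.
  by apply: has_mean_mahler_approx => v; exact: relations_split.
pose G t := iterated_integral (fun s : l.-tuple R =>
    lne (S * nm (\sum_i twist c b (expi2pi t) i *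
                 \prod_j expi2pi (tnth s j) ^ A' i j))%:E).
set I := iterated_integral _.
have -> : I = (\int[lebesgue_measure]_(t in `[0%R, 1%R]) G t)%E.
  rewrite /I [LHS]/iterated_integral -/(@iterated_integral R).
  apply: eq_integral => t _; congr iterated_integral.
  apply/funext => s; congr (lne (S * nm _)%:E); apply: eq_bigr => i _.
  rewrite (prod_exprz_rcons (@expi2pi R)) /twist -mulrA [X in c i * X]mulrC.
  by under [X in _ = _ * (_ * X)]eq_bigr do rewrite mxE.
rewrite (_ : (fun N => _) = fun N => (\int[lebesgue_measure]_(t in `[0%R, 1%R]) (g N t)%:E)%E).
  apply: (@nonincreasing_integral_cvg R g G (ln S)).
  - exact: ln_ge0.
  - by move=> N; apply: has_mean_measurable (hm N).
  - by move=> N t; rewrite /g gerDl mahler_approx_le0.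
  - by move=> t N M NM; rewrite lerD2l; exact: mahler_approx_nonincreasing.
  - by move=> t _; exact: IH.
by apply/funext => N; rewrite (has_mean_integral (hm N)).
Qed.

End IteratedIntegral.

(** * From Laurent polynomials to coefficients and lattices, and back *)

Section LaurentPolynomials.
Variables (R : realType) (k : nat).
Local Notation nm := (@Normc.normc R).

Definition exponent_matrix l (a : 'I_k -> 'rV[int]_l) : 'M[int]_(k, l) :=
  \matrix_(i, j) a i 0 j.

Lemma exponent_matrix_lattice l (a : 'I_k -> 'rV[int]_l) : injective a ->
  lattice (relations (exponent_matrix a)).
Proof.
move=> ai; split; first exact: relations_saturated.
move=> i j ij; rewrite /relations mulmxBl -!rowE subr_eq0.
apply: contra ij => /eqP E; apply/eqP/ai/rowP => t.
by have /rowP /(_ t) := E; rewrite !mxE.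
Qed.

Lemma laurent_evalE (K : fieldType) l (F : laurent l) (a : 'I_k -> 'rV[int]_l) (z : 'I_l -> K) :
  injective a -> (forall j, j \notin codom a -> F@_j = 0) ->
  laurent_eval F z = \sum_i (F@_(a i))%:~R * \prod_(j < l) z j ^ a i 0 j.
Proof.
move=> ai Fa; rewrite /laurent_eval.
have P : perm_eq (msupp F) [seq j <- codom a | j \in msupp F].
  apply: uniq_perm; [exact: fset_uniq|by rewrite filter_uniq // map_inj_uniq ?enum_uniq|].
  move=> j; rewrite mem_filter; case: (boolP (j \in msupp F)) => //= jF.
  by apply/esym; apply: contraTT jF => /Fa Fj; rewrite -mcoeff_neq0 Fj eqxx.
rewrite (perm_big _ P) big_filter big_mkcond /= big_image /=; apply: eq_bigr => i _.
by case: (msuppP F (a i)) => //; rewrite mul0r.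
Qed.

Lemma mahler_value l (F : laurent l) (a : 'I_k -> 'rV[int]_l) (y : R) :
  injective a -> (forall j, j \notin codom a -> F@_j = 0) ->
  nonzero (fun i => F@_(a i)) ->
  approx R (fun i => F@_(a i)) (relations (exponent_matrix a)) N @[N --> \oo] --> y ->
  mahler R F = y%:E.
Proof.
move=> ai Fa c0 cy; pose c i := F@_(a i).
have S1 := height_sum_ge1 R c0; have S0 := lt_le_trans ltr01 S1.
have H := @iterated_integral_cvg R k l (exponent_matrix a) (unit_coef R c) (height_sum R c)
  S1 (l1norm_unit_coef R c0).
have {}H : (approx R c (relations (exponent_matrix a)) N)%:E @[N --> \oo] --> mahler R F.
  rewrite /mahler; apply: cvg_trans H _.
  rewrite (_ : (fun t : l.-tuple R => _) = fun t : l.-tuple R => lne (height_sum R c *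
    nm (\sum_i unit_coef R c i * \prod_j expi2pi (tnth t j) ^ exponent_matrix a i j))%:E) //.
  apply/funext => t; congr (lne _%:E); rewrite (laurent_evalE _ ai Fa).
  rewrite -[X in X * _]gtr0_norm // -normc_real -Normc.normcM mulr_sumr.
  congr nm; apply: eq_bigr => i _; rewrite mulrA; congr (_ * _).
    rewrite /unit_coef -rmorphM /= mulrC divfK ?gt_eqF //.
    by rewrite rmorph_int.
  by apply: eq_bigr => j _; rewrite mxE.
have /cvg_lim <- // := H.
by apply/cvg_lim => //; apply: cvg_EFin => //; exact: nearW.
Qed.

End LaurentPolynomials.

Theorem theorem2 (R : realType) (k : nat) (hk : (1 <= k)%N) :
  exists A : set R,
    [/\ mahler_values R k = EFin @` A,
        A `<=` [set x : R | 0 <= x],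
        closed A &
        isolated A 0].
Proof.
exists (@value_set R k); split; last exact: value_set_isolated; last exact: closed_value_set;
  last exact: value_set_ge0.
apply/seteqP; split => [x [l [F [_ F0 [J cJ FJ] <-]]]|_ [y [c [r [c0 rL cy]]] <-]].
  (* Enumerating J, zero coefficients included, gives exactly k distinct exponents. *)
  pose a (i : 'I_k) := nth 0 (enum_fset J) i.
  have sJ : size (enum_fset J) = k by rewrite -cJ.
  have ai : injective a.
    move=> i j /eqP; rewrite nth_uniq ?sJ ?ltn_ord ?fset_uniq // => /eqP; exact: val_inj.
  have Fa j : j \notin codom a -> F@_j = 0.
    move=> ja; apply: FJ; apply: contra ja => jJ; apply/codomP.
    have jk : (index j (enum_fset J) < k)%N by rewrite -sJ index_mem.
    by exists (Ordinal jk); rewrite /a /= nth_index.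
  have c0 : nonzero (fun i => F@_(a i)).
    apply: contrapT => /forallNP H; move/negP: F0; apply; apply/eqP/malgP => j.
    rewrite mcoeff0; have [/codomP[i ->]|/Fa //] := boolP (j \in codom a).
    by apply/eqP; apply: contraT => /H.
  have aL := exponent_matrix_lattice ai; have [y cy] := approx_cvg R c0 aL.
  exists y; first by exists (fun i => F@_(a i)), (relations (exponent_matrix a)).
  by rewrite (mahler_value ai Fa c0 cy).
(* Conversely, the rows of B serve as exponents in k variables; they are distinct because the
   lattice contains no e_i - e_j. *)
have [B rB] := saturated_relations rL.1; pose a i := row i B.
have BE : exponent_matrix a = B by apply/matrixP => i j; rewrite !mxE.
have ai : injective a.
  move=> i j aij; apply/eqP; apply: contraT => ij; have := rL.2 i j ij.
  by rewrite rB /relations mulmxBl -!rowE -/(a i) -/(a j) aij subrr eqxx.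
pose F : laurent k := \sum_i << c i *g a i >>.
have Fc i : F@_(a i) = c i.
  rewrite /F raddf_sum (bigD1 i) //= mcoeffUU big1 ?addr0 // => j ji.
  by rewrite mcoeffU (inj_eq ai) (negPf ji).
have Fa j : j \notin codom a -> F@_j = 0.
  move=> ja; rewrite /F raddf_sum big1 // => i _; rewrite /= mcoeffU.
  by rewrite (negPf (_ : a i != j)) //; apply: contra ja => /eqP <-; exact: codom_f.
have cE : (fun i => F@_(a i)) = c by apply/funext.
exists k, F; split => //.
- have [i ci] := c0; apply: contra ci => /eqP F0; by rewrite -Fc F0 mcoeff0.
- exists [fset a i | i in 'I_k]%fset; first by rewrite card_imfset //= size_enum_ord.
  move=> j ja; apply: Fa; apply: contra ja => /codomP[i ->]; exact/in_imfset.
- by apply: (@mahler_value R k k F a) => //; rewrite cE // BE -rB.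
Qed.
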